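(* Let $H$ be a separable infinite-dimensional complex Hilbert space. Then the $\overline{\mathbb{D}}$-rigid operators on $H$ form a dense $G_\delta$ set in $(\mathcal{U},\mathrm{SOT}^* )$ and in $(\mathcal{I},\mathrm{SOT})$, and a comeager set in $(\mathcal{C},\mathrm{WOT})$.
   Context: $\mathcal{C}$, $\mathcal{I}$, $\mathcal{U}$ denote the sets of contractions, (linear) isometries and unitary operators on $H$. WOT and SOT are the weak and strong operator topologies; $\mathrm{SOT}^*$ is the topology in which $T_\alpha\to T$ iff $T_\alpha\to T$ and $T_\alpha^*\to T^*$ strongly. A set is comeager if it contains a dense $G_\delta$ set. For $\lambda\in\mathbb{C}$, a bounded operator $T$ on $H$ is $\lambda$-rigid if there is a strictly increasing sequence $(n_k)$ in $\mathbb{N}$ with $T^{n_k}\to\lambda I$ in the weak operator topology. $T$ is $\overline{\mathbb{D}}$-rigid if it is $\lambda$-rigid for every $\lambda\in\mathbb{C}$ with $|\lambda|\le 1$. The statement about a space refers to the set of elements of that space which are $\overline{\mathbb{D}}$-rigid. *)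

(* Defs.v *)
From HB Require Import structures.
From mathcomp Require Import all_boot all_order all_algebra.
From mathcomp Require Import sesquilinear.
From mathcomp Require Import complex.
From mathcomp Require Import all_classical all_reals all_analysis.
From mathcomp Require Import borel_hierarchy.

Set Implicit Arguments.
Unset Strict Implicit.
Unset Printing Implicit Defensive.

Import Order.TTheory GRing.Theory Num.Theory.
Import numFieldNormedType.Exports.

Local Open Scope classical_set_scope.
Local Open Scope ring_scope.

(* The inner product is linear in its first argument and conjugate-linear in
   the second. *)
HB.mixin Record isHilbert (R : realType) (H : Type)
    & CompleteNormedModule R[i] H := {
  inner : {dot H for (@Num.conj R[i])} ;
  inner_norm : forall x : H, `|x| ^+ 2 = inner x x
}.

#[short(type="hilbertType")]
HB.structure Definition Hilbert (R : realType) :=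
  { H of isHilbert R H & CompleteNormedModule R[i] H }.

Definition separable (T : topologicalType) : Prop :=
  exists2 D : set T, countable D & dense D.

Definition finite_dimensional (K : nzRingType) (V : lmodType K) : Prop :=
  exists (n : nat) (e : 'I_n -> V),
    forall x : V, exists c : 'I_n -> K, x = \sum_(i < n) c i *: e i.

Section BoundedOperators.
Context {R : realType} {H : hilbertType R}.

Record boundedOp : Type := BoundedOp {
  op_fun :> {linear H -> H} ;
  op_bounded : exists M : R[i], forall x : H, `|op_fun x| <= M * `|x|
}.

HB.instance Definition _ := gen_eqMixin boundedOp.
HB.instance Definition _ := gen_choiceMixin boundedOp.

Lemma scalar_op_bounded (a : R[i]) :
  exists M : R[i], forall x : H, `|(a \*: (@idfun H)) x| <= M * `|x|.
Proof. by exists `|a| => x; rewrite /= normrZ. Qed.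

Definition scalar_op (a : R[i]) : boundedOp :=
  BoundedOp (scalar_op_bounded a).

Lemma comp_op_bounded (S T : boundedOp) :
  exists M : R[i], forall x : H, `|(S \o T) x| <= M * `|x|.
Proof.
have [M SM] := op_bounded S; have [N TN] := op_bounded T.
exists (`|M| * `|N|) => x /=.
have [->|x0] := eqVneq x 0; first by rewrite !linear0 !normr0 mulr0.
have M0 : `|S (T x)| <= `|M| * `|T x|.
  have [->|y0] := eqVneq (T x) 0; first by rewrite linear0 !normr0 mulr0.
  apply: (le_trans (SM _)); rewrite ler_pM2r ?normr_gt0//.
  rewrite ger0_norm// -(pmulr_lge0 _ (_ : 0 < `|T x|)) ?normr_gt0//.
  exact: le_trans (SM _).
have N0 : 0 <= N.
  rewrite -(pmulr_lge0 _ (_ : 0 < `|x|)) ?normr_gt0//.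
  exact: le_trans (TN _).
by apply: (le_trans M0); rewrite -mulrA ler_wpM2l// (ger0_norm N0).
Qed.

Definition comp_op (S T : boundedOp) : boundedOp :=
  BoundedOp (comp_op_bounded S T).

Definition pow_op (T : boundedOp) (n : nat) : boundedOp :=
  iter n (comp_op T) (scalar_op 1).

(* By the Riesz representation theorem there is exactly one such operator, so
   the default value given to [xget] is never used. *)
Definition adjoint (T : boundedOp) : boundedOp :=
  xget (scalar_op 0)
    [set S : boundedOp | forall x y : H, inner (T x) y = inner x (S y)].

Definition contraction_op : set boundedOp :=
  [set T | forall x : H, `|T x| <= `|x|].

Definition isometric_op : set boundedOp :=
  [set T | forall x : H, `|T x| = `|x|].

Definition unitary_op : set boundedOp :=
  [set T | comp_op (adjoint T) T = scalar_op 1 /\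
           comp_op T (adjoint T) = scalar_op 1].

(* Each operator topology is the initial topology of a map from [boundedOp] to
   a space of functions with pointwise convergence; the three types below are
   convertible to [boundedOp]. *)
Definition WOT : Type := initial_topology
  (fun T : boundedOp =>
     (fun p : H * H => inner (T p.1) p.2) : {ptws (H * H)%type -> R[i]^o}).
Definition SOT : Type := initial_topology
  (fun T : boundedOp => (fun x : H => T x) : {ptws H -> H}).
Definition SOTstar : Type := initial_topology
  (fun T : boundedOp =>
     (fun x : H => (T x, adjoint T x)) : {ptws H -> (H * H)%type}).

HB.instance Definition _ := Topological.on WOT.
HB.instance Definition _ := Topological.on SOT.
HB.instance Definition _ := Topological.on SOTstar.

Definition rigid (lambda : R[i]) (T : boundedOp) : Prop :=
  exists n : nat -> nat,
    {homo n : j k / (j < k)%N} /\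
    (fun k => pow_op T (n k) : WOT) @ \oo --> (scalar_op lambda : WOT).

Definition disk_rigid : set boundedOp :=
  [set T | forall lambda : R[i], `|lambda| <= 1 -> rigid lambda T].

End BoundedOperators.

Arguments boundedOp {R} H.
Arguments WOT {R} H.
Arguments SOT {R} H.
Arguments SOTstar {R} H.

Definition dense_Gdelta (T : topologicalType) (A : set T) : Prop :=
  Gdelta A /\ dense A.

Definition comeager (T : topologicalType) (A : set T) : Prop :=
  exists2 B : set T, dense_Gdelta B & B `<=` A.

(* The part of [P] lying in [A], as a subset of the space [A] itself, where [A]
   carries the topology induced from [T] (which must be given explicitly when
   several topologies live on the same type). *)
Definition trace_in (T : topologicalType) (A P : set T) : set (set_type A) :=
  [set x | P (\val x)].

(* Main.v *)
From HB Require Import structures.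
From Stdlib Require PeanoNat.
Require Import Defs.
From mathcomp Require Import all_boot all_order all_algebra.
From mathcomp Require Import sesquilinear.
From mathcomp Require Import complex.
From mathcomp Require Import all_classical all_reals all_analysis.
From mathcomp Require Import borel_hierarchy.
From mathcomp Require Import ring lra.

(* For a contraction T, disk-rigidity amounts to countably many conditions,
   each asking that some late power of T be close to a target l_k, tested on
   finitely many basis vectors, where (l_k) is dense in the disk.  Powers are
   strongly continuous on contractions, and contractions converging weakly to
   an isometry converge strongly.  So everything reduces to one density
   statement: disk-rigid unitaries approximate every contraction weakly.

   Dilation.  After multiplication by a real r < 1, a contraction is, up to a
   small error, the compression of the cyclic shift V of N + 1 copies of H to
   an isometric image of a given finite set of vectors; a product of
   reflections carries that image back to the given vectors.

   Perturbation.  V has finite order and commutes with the commuting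
   involutions S_k flipping the k-th binary digit of the basis index inside
   each copy, and S_k tends weakly to 0.  Let W be the product of V and all
   U_k := (z_k + w_k)/2 + (z_k - w_k)/2 S_k, with z_k, w_k roots of unity close
   to 1.  The exponents n_k are chosen so that V^n_k = 1, U_j^n_k = 1 for
   j < k, U_k^n_k = l_k + c_k S_k with |c_k| <= 1, and so that the factors U_j
   with j > k are too close to 1 to matter.  Then W^n_k - l_k tends weakly
   to 0. *)

Set Implicit Arguments.
Unset Strict Implicit.
Unset Printing Implicit Defensive.

Import Order.TTheory GRing.Theory Num.Theory.
Import numFieldNormedType.Exports.

Local Open Scope classical_set_scope.
Local Open Scope ring_scope.
Local Open Scope complex_scope.
Local Notation "a ^*" := (conjc a) : ring_scope.

(** * Norms and inner products *)

Section NormBasics.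
Context {R : realType}.
Implicit Types V : normedZmodType R[i].

(* Norms take values in [R[i]], which is only partially ordered; [nr] reads
   them in [R]. *)
Definition nr {V} (x : V) : R := complex.Re `|x|.

Lemma nrE V (x : V) : `|x| = (nr x)%:C.
Proof. by rewrite /nr RRe_real// normr_real. Qed.

Lemma nr_ge0 V (x : V) : 0 <= nr x.
Proof. by rewrite -ler0c -nrE. Qed.

Lemma nr0 V : nr (0 : V) = 0.
Proof. by rewrite /nr normr0. Qed.

Lemma nr0_eq0 V (x : V) : nr x = 0 -> x = 0.
Proof. by move=> x0; apply/eqP; rewrite -normr_eq0 nrE x0. Qed.

Lemma nr_gt0 V (x : V) : x != 0 -> 0 < nr x.
Proof. by rewrite -normr_gt0 nrE ltcR. Qed.

Lemma nrD V (x y : V) : nr (x + y) <= nr x + nr y.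
Proof. by rewrite -lecR rmorphD/= -!nrE ler_normD. Qed.

Lemma nrN V (x : V) : nr (- x) = nr x.
Proof. by rewrite /nr normrN. Qed.

Lemma nrBC V (x y : V) : nr (x - y) = nr (y - x).
Proof. by rewrite /nr distrC. Qed.

Lemma nr_tri V (z x y : V) : nr (x - y) <= nr (x - z) + nr (z - y).
Proof. by rewrite (le_trans _ (nrD _ _))// addrA subrK. Qed.

Lemma nrM (a b : R[i]) : nr (a * b) = nr a * nr b.
Proof. by apply: complexI; rewrite rmorphM/= -!nrE normrM. Qed.

Lemma nr1 : nr (1 : R[i]) = 1.
Proof. by rewrite /nr normr1. Qed.

Lemma nr_real (a : R) : nr (a%:C : R[i]) = `|a|.
Proof. by rewrite /nr normc_def/= expr0n/= addr0 sqrtr_sqr. Qed.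

Lemma nr_half : nr (2^-1 : R[i]) = 2^-1.
Proof.
rewrite -[2^-1](_ : (2^-1)%:C = _) ?nr_real ?ger0_norm//.
by rewrite fmorphV rmorph_nat.
Qed.

Lemma nr_sqr (a : R[i]) : nr a ^+ 2 = complex.Re a ^+ 2 + complex.Im a ^+ 2.
Proof.
by apply: complexI; rewrite rmorphXn/= -nrE add_Re2_Im2.
Qed.

Lemma Re_le_nr (a : R[i]) : `|complex.Re a| <= nr a.
Proof.
rewrite -(@ler_pXn2r _ 2) ?nnegrE ?nr_ge0// nr_sqr real_normK ?num_real//.
by rewrite lerDl sqr_ge0.
Qed.

Lemma nr_conj (a : R[i]) : nr (a^*) = nr a.
Proof.
apply/eqP; rewrite -(@eqrXn2 _ 2) ?nr_ge0// !nr_sqr; case: a => a b /=.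
by rewrite sqrrN.
Qed.

Lemma nrZ (W : normedModType R[i]) (a : R[i]) (x : W) : nr (a *: x) = nr a * nr x.
Proof. by apply: complexI; rewrite rmorphM/= -!nrE normrZ. Qed.

Lemma nr_cvgP (W : normedModType R[i]) T (F : set_system T) (f : T -> W) (l : W) :
  Filter F ->
  f @ F --> l <-> forall e : R, 0 < e -> \forall t \near F, nr (l - f t) < e.
Proof.
move=> FF; split=> [/cvgrPdist_lt cf e e0|cf].
  have e0C : 0 < (e%:C : R[i]) by rewrite ltcR.
  by near do rewrite -ltcR -nrE; exact: cf.
apply/cvgrPdist_lt => e e0.
have eE : e = (complex.Re e)%:C by rewrite RRe_real// gtr0_real.
have : 0 < complex.Re e by rewrite -ltcR -eE.
by move=> /cf; apply: filterS => t; rewrite -ltcR -nrE -eE.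
Unshelve. all: by end_near. Qed.

(* Same as [nr_cvgP] for [R[i]^o], but the norm on the right is that of [R[i]]
   itself, a distinct though convertible instance. *)
Lemma nr_cvgCP T (F : set_system T) (f : T -> R[i]) (l : R[i]) : Filter F ->
  (f : T -> R[i]^o) @ F --> (l : R[i]^o) <->
  forall e : R, 0 < e -> \forall t \near F, nr (l - f t) < e.
Proof. by move=> FF; exact: (@nr_cvgP (R[i]^o)). Qed.

Lemma nr_cvg_unique (W : normedModType R[i]) T (F : set_system T) (f : T -> W)
    (l l' : W) :
  ProperFilter F -> f @ F --> l -> f @ F --> l' -> l = l'.
Proof. by move=> PF fl fl'; exact: (norm_cvg_unique fl fl'). Qed.

End NormBasics.

Section InnerBasics.
Context {R : realType} {H : hilbertType R}.
Implicit Types (x y z : H) (a : R[i]).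

Local Notation "'<[' x , y ]>" := (inner x y).

Lemma ipDl x y z : <[x + y, z]> = <[x, z]> + <[y, z]>.
Proof. exact: linearDl. Qed.

Lemma ipDr x y z : <[z, x + y]> = <[z, x]> + <[z, y]>.
Proof. exact: linearDr. Qed.

Lemma ipZl a x y : <[a *: x, y]> = a * <[x, y]>.
Proof. exact: linearZl_LR. Qed.

Lemma ipZr a x y : <[x, a *: y]> = a^* * <[x, y]>.
Proof. exact: linearZr_LR. Qed.

Lemma ipC x y : <[y, x]> = <[x, y]>^*.
Proof.
by have := @hermitian_subproof _ _ _ _ (@inner R H) y x; rewrite expr0 mul1r.
Qed.

Lemma ip_nr x : <[x, x]> = (nr x ^+ 2)%:C.
Proof. by rewrite -inner_norm nrE rmorphXn. Qed.

End InnerBasics.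

Section InnerMore.
Context {R : realType} {H : hilbertType R}.
Implicit Types (x y z : H) (a : R[i]).

Local Notation "'<[' x , y ]>" := (inner x y).

Lemma ip0l y : <[0, y]> = 0.
Proof. by rewrite -(scale0r (0 : H)) ipZl mul0r. Qed.

Lemma ip0r x : <[x, 0]> = 0.
Proof. by rewrite ipC ip0l conjc0. Qed.

Lemma ipNl x y : <[- x, y]> = - <[x, y]>.
Proof. by rewrite -scaleN1r ipZl mulN1r. Qed.

Lemma ipNr x y : <[x, - y]> = - <[x, y]>.
Proof. by rewrite ipC ipNl rmorphN/= -ipC. Qed.

Lemma ipBl x y z : <[x - y, z]> = <[x, z]> - <[y, z]>.
Proof. by rewrite ipDl ipNl. Qed.

Lemma ipBr x y z : <[z, x - y]> = <[z, x]> - <[z, y]>.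
Proof. by rewrite ipDr ipNr. Qed.

Lemma ip_suml I (r : seq I) (F : I -> H) y :
  <[\sum_(i <- r) F i, y]> = \sum_(i <- r) <[F i, y]>.
Proof.
elim: r => [|i r IH]; first by rewrite !big_nil ip0l.
by rewrite !big_cons ipDl IH.
Qed.

Lemma ip_sumr I (r : seq I) (F : I -> H) y :
  <[y, \sum_(i <- r) F i]> = \sum_(i <- r) <[y, F i]>.
Proof.
elim: r => [|i r IH]; first by rewrite !big_nil ip0r.
by rewrite !big_cons ipDr IH.
Qed.

Lemma nrD_sqr x y :
  nr (x + y) ^+ 2 = nr x ^+ 2 + nr y ^+ 2 + 2 * complex.Re <[x, y]>.
Proof.
apply: complexI; rewrite -ip_nr ipDl !ipDr !ip_nr (ipC x y).
by case: (<[x, y]>) => u v; apply/eqP; rewrite eq_complex/=; apply/andP; split;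
  apply/eqP; ring.
Qed.

Lemma nrB_sqr x y :
  nr (x - y) ^+ 2 = nr x ^+ 2 + nr y ^+ 2 - 2 * complex.Re <[x, y]>.
Proof. by rewrite nrD_sqr nrN ipNr -mulrN; congr (_ + 2 * _); case: (<[x, y]>). Qed.

Lemma cauchy_schwarz x y : nr <[x, y]> <= nr x * nr y.
Proof.
have [->|y0] := eqVneq y 0; first by rewrite ip0r !nr0 mulr0.
have ny := nr_gt0 y0.
have ny0 : nr y != 0 by rewrite gt_eqF.
set c := <[x, y]>.
have := sqr_ge0 (nr (x - ((nr y ^- 2)%:C * c) *: y)).
rewrite nrB_sqr nrZ nrM nr_real ger0_norm ?invr_ge0 ?sqr_ge0// ipZr -/c.
have -> : complex.Re (((nr y ^- 2)%:C * c)^* * c) = nr y ^- 2 * nr c ^+ 2.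
  by rewrite nr_sqr; case: (c) => u v /=; ring.
rewrite !exprMn => h.
rewrite -(@ler_pXn2r _ 2) ?nnegrE ?mulr_ge0 ?nr_ge0// exprMn -ler_pdivrMr ?exprn_gt0//.
rewrite -subr_ge0 (le_trans h)// le_eqVlt; apply/orP; left; apply/eqP.
by field.
Qed.

Lemma ip_conv (T : Type) (F : set_system T) (f : T -> H) l y :
  Filter F -> f @ F --> l -> (fun t => <[f t, y]> : R[i]^o) @ F --> (<[l, y]> : R[i]^o).
Proof.
move=> FF /nr_cvgP fl; apply/nr_cvgP => e e0.
have d0 : 0 < e / (nr y + 1) by rewrite divr_gt0// ltr_wpDl ?nr_ge0.
apply: filterS (fl _ d0) => t; rewrite -ipBl ltr_pdivlMr ?ltr_wpDl ?nr_ge0// => lt.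
rewrite (le_lt_trans (cauchy_schwarz _ _))// (le_lt_trans _ lt)//.
by rewrite ler_wpM2l ?nr_ge0// lerDl.
Qed.

End InnerMore.

(** * Bounded operators and unitaries *)

Section Operators.
Context {R : realType} {H : hilbertType R}.
Implicit Types (x y z : H) (a : R[i]) (S T U V : boundedOp H).

Local Notation "'<[' x , y ]>" := (inner x y).

(** Beyond the function, an operator carries only proofs of linearity and boundedness, so
    extensionality and proof irrelevance give the equality that [unitary_op] is stated with. *)
Lemma op_eq S T : S =1 T -> S = T.
Proof.
case: S => S bS; case: T => T bT /= eST.
have {eST} eST : S = T.
  case: S bS eST => S cS bS; case: T bT => T cT bT /= /funext eST; subst T.
  case: cS {bS} => -[a] [b]; case: cT {bT} => -[a'] [b'].
  by rewrite (Prop_irrelevance a a') (Prop_irrelevance b b').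
subst T; congr BoundedOp; exact: Prop_irrelevance.
Qed.

Lemma op_exists (f : H -> H) (M : R) :
  (forall a x y, f (a *: x + y) = a *: f x + f y) ->
  (forall x, nr (f x) <= M * nr x) -> exists T, forall x, T x = f x.
Proof.
move=> fL fM.
pose mf := GRing.isLinear.Build R[i] H H *:%R f fL.
pose F : {linear H -> H} := HB.pack f mf.
have bF : exists M : R[i], forall x : H, `|F x| <= M * `|x|.
  by exists M%:C => x; rewrite !nrE -rmorphM/= lecR; exact: fM.
by exists (BoundedOp bF).
Qed.

Lemma scalar_opE a x : scalar_op a x = a *: x.
Proof. by []. Qed.

Lemma opZ T a x : T (a *: x) = a *: T x.
Proof. exact: linearZ. Qed.

Lemma scalar1E x : scalar_op 1 x = x.
Proof. exact: scale1r. Qed.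

Lemma pow_opS T n x : pow_op T n.+1 x = T (pow_op T n x).
Proof. by []. Qed.

Lemma pow_opSr T n x : pow_op T n.+1 x = pow_op T n (T x).
Proof.
elim: n => [|n IH]; first by rewrite pow_opS !scalar1E.
by rewrite pow_opS IH -pow_opS.
Qed.

Lemma pow_opD T m n x : pow_op T (m + n) x = pow_op T m (pow_op T n x).
Proof. by elim: m => [|m IH]; rewrite ?add0n ?scalar1E// addSn !pow_opS IH. Qed.

Lemma pow_op_mul1 T m n x :
  (forall x, pow_op T m x = x) -> pow_op T (m * n) x = x.
Proof.
by move=> Tm; elim: n => [|n IH]; rewrite ?muln0 ?scalar1E// mulnS pow_opD Tm.
Qed.

Lemma pow_op_commute S T n x :
  (forall x, S (T x) = T (S x)) -> S (pow_op T n x) = pow_op T n (S x).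
Proof.
by move=> ST; elim: n => [|n IH]; rewrite ?scalar1E// !pow_opS ST IH.
Qed.

Lemma pow_comp S T n x : (forall x, S (T x) = T (S x)) ->
  pow_op (comp_op S T) n x = pow_op S n (pow_op T n x).
Proof.
move=> ST; elim: n x => [|n IH] x; rewrite ?scalar1E//.
by rewrite pow_opSr IH [RHS]pow_opSr (pow_op_commute _ _ ST) pow_opSr/= ST.
Qed.

Lemma contractionP T : contraction_op T <-> forall x, nr (T x) <= nr x.
Proof. by split=> h x; move: (h x); rewrite !nrE lecR. Qed.

Lemma contraction_pow T n : contraction_op T -> contraction_op (pow_op T n).
Proof.
move=> /contractionP cT; apply/contractionP => x.
elim: n => [|n IH]; first by rewrite scalar1E.
by rewrite pow_opS (le_trans (cT _)).
Qed.

Lemma contraction_comp S T :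
  contraction_op S -> contraction_op T -> contraction_op (comp_op S T).
Proof.
move=> /contractionP cS /contractionP cT; apply/contractionP => x.
exact: le_trans (cS _) (cT _).
Qed.

(** A unitary kept together with its inverse, so that constructions avoid [adjoint], which is
    defined by choice. Mutually inverse contractions are isometric, hence adjoint to each other. *)
Definition unitary_pair U V :=
  [/\ contraction_op U, contraction_op V, cancel U V & cancel V U].

Lemma unitary_pairC U V : unitary_pair U V -> unitary_pair V U.
Proof. by case. Qed.

Lemma unitary_pair_nr U V x : unitary_pair U V -> nr (U x) = nr x.
Proof.
case=> /contractionP cU /contractionP cV UV _; apply/eqP.
by rewrite eq_le cU -{1}(UV x) cV.
Qed.

(** Polarization: norms of sums give the real part, and replacing [y] by i y gives the imaginary
    part. *)
Lemma isometry_ip T x y : (forall x, nr (T x) = nr x) -> <[T x, T y]> = <[x, y]>.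
Proof.
move=> iT.
have ReE u v : complex.Re <[T u, T v]> = complex.Re <[u, v]>.
  have := nrD_sqr (T u) (T v); rewrite -linearD !iT nrD_sqr => h; lra.
apply/eqP; rewrite eq_complex ReE eqxx/=; apply/eqP.
have := ReE x ('i%C *: y); rewrite linearZ/= !ipZr.
by case: (<[_, _]>) => a b; case: (<[_, _]>) => c d /=; lra.
Qed.

Lemma unitary_pair_ip U V x y : unitary_pair U V -> <[U x, y]> = <[x, V y]>.
Proof.
move=> UV; have [_ _ _ VU] := UV.
by rewrite -{1}(VU y) (isometry_ip _ _ (fun x => unitary_pair_nr x UV)).
Qed.

Lemma unitary_pair_comp U V U' V' : unitary_pair U V -> unitary_pair U' V' ->
  unitary_pair (comp_op U U') (comp_op V' V).
Proof.
move=> [cU cV UV VU] [cU' cV' UV' VU']; split; try exact: contraction_comp.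
- by move=> x /=; rewrite UV UV'.
- by move=> x /=; rewrite VU' VU.
Qed.

Lemma unitary_pair1 : unitary_pair (scalar_op 1) (scalar_op 1).
Proof.
have c1 : contraction_op (scalar_op 1 : boundedOp H).
  by move=> x; rewrite scalar1E.
by split=> // x; rewrite !scalar1E.
Qed.

Lemma adjoint_pair U V : unitary_pair U V -> adjoint U = V.
Proof.
move=> UV; rewrite /adjoint; case: xgetP => [S _ SU|/(_ V)[]]; last first.
  by move=> x y /=; rewrite (unitary_pair_ip _ _ UV).
apply: op_eq => y; apply/eqP; rewrite -subr_eq0; apply/eqP/nr0_eq0/eqP.
rewrite -sqrf_eq0; apply/eqP/complexI; rewrite -ip_nr {1}ipBr -SU.
by rewrite -(unitary_pair_ip _ _ UV) subrr.
Qed.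

Lemma unitary_opP U : unitary_op U <-> exists V, unitary_pair U V.
Proof.
split=> [[VU UV]|[V UV]]; last first.
  rewrite /unitary_op/= (adjoint_pair UV); case: UV => _ _ UV VU.
  by split; apply: op_eq => x /=; rewrite scalar1E ?UV ?VU.
exists (adjoint U).
have {}VU x : adjoint U (U x) = x.
  by have := congr1 (fun T : boundedOp H => T x) VU; rewrite /= scale1r.
have {}UV x : U (adjoint U x) = x.
  by have := congr1 (fun T : boundedOp H => T x) UV; rewrite /= scale1r.
have adj x y : <[U x, y]> = <[x, adjoint U y]>.
  move: VU; rewrite /adjoint; case: xgetP => [S _ SU _|_ VU]; first exact: SU.
  (* If no adjoint existed, [adjoint U] would be the default zero operator, and [VU] would force
     every vector to be zero. *)
  have H0 z : z = 0 :> H by rewrite -(VU z)/= scale0r.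
  by rewrite (H0 x) linear0 !ip0l.
have nU x : nr (U x) = nr x.
  apply/eqP; rewrite -(@eqrXn2 _ 2) ?nr_ge0//; apply/eqP/complexI.
  by rewrite -!ip_nr adj VU.
by split=> //; apply/contractionP => x; rewrite ?nU// -{2}(UV x) nU.
Qed.

End Operators.

(** * Reflections, Gram-Schmidt, and orthonormal bases *)

Section Reflections.
Context {R : realType} {H : hilbertType R}.
Implicit Types (x y z : H) (a : R[i]) (S T U V : boundedOp H).

Local Notation "'<[' x , y ]>" := (inner x y).

(** |T x|^2 - |x|^2 expands to |<x, u>|^2 (|u|^2 |d|^2 - 2 Re d), which the condition on [d] makes
    zero. *)
Lemma reflection_op (u : H) (d : R[i]) : d + d^* = (nr u ^+ 2)%:C * (d * d^*) ->
  exists T : boundedOp H, (forall x, T x = x - (<[x, u]> * d) *: u) /\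
    (forall x, nr (T x) = nr x).
Proof.
move=> dd; set f := fun x => x - (<[x, u]> * d) *: u.
have fnr x : nr (f x) = nr x.
  apply/eqP; rewrite -(@eqrXn2 _ 2) ?nr_ge0//; apply/eqP.
  rewrite /f nrB_sqr nrZ ipZr exprMn nr_sqr.
  move: dd => /eqP; rewrite eq_complex => /andP[/eqP + _].
  by case: (<[x, u]>) => p q; case: d {f} => s t /= h; nra.
have [|x|T TE] := @op_exists _ _ f 1; last first.
- by exists T; split=> x; rewrite TE.
- by rewrite fnr mul1r.
move=> a x y; rewrite /f ipDl ipZl mulrDl scalerDl scalerBr scalerA mulrA.
by rewrite opprD addrACA.
Qed.

(** Take u = a - b and d = 1 / <a, u>, so that a is sent to a - u = b. Equality of the norms gives 2
    Re <a, u> = |u|^2, the condition of [reflection_op]; the conjugate of d gives the inverse.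
    Vectors orthogonal to u are fixed. *)
Lemma householder (a b : H) : nr a = nr b -> exists U V, unitary_pair U V /\
  U a = b /\ forall x, <[x, a]> = <[x, b]> -> U x = x.
Proof.
move=> nab; have [->|ab] := eqVneq a b.
  exists (scalar_op 1), (scalar_op 1); split; first exact: unitary_pair1.
  by split=> *; rewrite scalar1E.
pose u := a - b; pose c := <[a, u]>.
have cE : c + c^* = (nr u ^+ 2)%:C.
  rewrite /c /u nrB_sqr -nab ipBr ip_nr.
  by case: (<[a, b]>) => p q; apply/eqP; rewrite eq_complex/=; apply/andP; split;
    apply/eqP; ring.
have u0 : nr u != 0 by rewrite gt_eqF// nr_gt0// subr_eq0.
have c0 : c != 0.
  apply/eqP => c0; move: cE; rewrite c0 conjc0 addr0 => /esym/eqP.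
  by rewrite eq_complex/= expf_eq0/= (negPf u0).
have cc0 : c^* != 0 by rewrite conjc_eq0.
have dd : c^-1 + c^-1^* = (nr u ^+ 2)%:C * (c^-1 * c^-1^*).
  by rewrite -cE conjc_inv; move: (c^*) cc0 => w w0; field; rewrite c0 w0.
have dd' : c^-1^* + c^-1^*^* = (nr u ^+ 2)%:C * (c^-1^* * c^-1^*^*).
  by rewrite conjcK addrC dd [c^-1 * _]mulrC.
have [U [UE Un]] := reflection_op dd; have [V [VE Vn]] := reflection_op dd'.
exists U, V; split; [split|split].
- by apply/contractionP => x; rewrite Un.
- by apply/contractionP => x; rewrite Vn.
- move=> x; rewrite VE !UE ipBl ipZl ip_nr -addrA -opprD -scalerDl.
  rewrite [X in X *: u](_ : _ = 0) ?scale0r ?subr0//.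
  transitivity (<[x, u]> * (c^-1 + c^-1^* - (nr u ^+ 2)%:C * (c^-1 * c^-1^*))); first by ring.
  by rewrite dd subrr mulr0.
- move=> x; rewrite UE !VE ipBl ipZl ip_nr -addrA -opprD -scalerDl.
  rewrite [X in X *: u](_ : _ = 0) ?scale0r ?subr0//.
  transitivity (<[x, u]> * (c^-1 + c^-1^* - (nr u ^+ 2)%:C * (c^-1 * c^-1^*))); first by ring.
  by rewrite dd subrr mulr0.
- by rewrite UE divff// scale1r opprB addrC subrK.
- by move=> x xab; rewrite UE ipBr xab subrr mul0r scale0r subr0.
Qed.

(** Vectors are moved one at a time: the reflection taking U (f n) to g n fixes the earlier g i,
    because <g i, U (f n)> = <f i, f n> = <g i, g n>. *)
Lemma gram_unitary n (f g : nat -> H) :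
  (forall i j, (i < n)%N -> (j < n)%N -> <[f i, f j]> = <[g i, g j]>) ->
  exists U V, unitary_pair U V /\ forall i, (i < n)%N -> U (f i) = g i.
Proof.
elim: n => [|n IH] fg.
  by exists (scalar_op 1), (scalar_op 1); split=> //; exact: unitary_pair1.
have [|U [V [UV Uf]]] := IH; first by move=> i j /ltnW lin /ltnW ljn; exact: fg.
have nU x := unitary_pair_nr x UV.
have nab : nr (U (f n)) = nr (g n).
  rewrite nU; apply/eqP; rewrite -(@eqrXn2 _ 2) ?nr_ge0//; apply/eqP/complexI.
  by rewrite -!ip_nr fg.
have [U' [V' [UV' [U'f U'x]]]] := householder nab.
exists (comp_op U' U), (comp_op V V'); split; first exact: unitary_pair_comp.
move=> i; rewrite ltnS leq_eqVlt => /orP[/eqP->//|lin] /=.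
by rewrite Uf// U'x// -{1}Uf// (isometry_ip _ _ nU) fg// ltnW.
Qed.

End Reflections.

(** * Gram-Schmidt for a positive definite form *)

Section GramSchmidt.
Context {R : realType} {H : lmodType R[i]}.
(** The form stays abstract because it is instantiated twice: with the inner product, to get a
    basis, and with the defect form of a strict contraction, to factor it. *)
Variable q : H -> H -> R[i].
Hypothesis qP : forall a x y z, q (a *: x + y) z = a * q x z + q y z.
Hypothesis qC : forall x y, q y x = (q x y)^*.
Hypothesis q_gt0 : forall x, x != 0 -> 0 < q x x.
Hypothesis Hinf : ~ finite_dimensional H.

Let qD x y z : q (x + y) z = q x z + q y z.
Proof. by rewrite -{1}(scale1r x) qP mul1r. Qed.

Let q0 z : q 0 z = 0.
Proof. by apply: (addrI (q 0 z)); rewrite -qD !addr0. Qed.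

Let qZ a x z : q (a *: x) z = a * q x z.
Proof. by rewrite -[a *: x]addr0 qP q0 addr0. Qed.

Let qZr a x z : q z (a *: x) = a^* * q z x.
Proof. by rewrite qC qZ rmorphM/= -qC. Qed.

Let q_sum I (r : seq I) (F : I -> H) y :
  q (\sum_(i <- r) F i) y = \sum_(i <- r) q (F i) y.
Proof.
elim: r => [|i r IH]; first by rewrite !big_nil q0.
by rewrite !big_cons qD IH.
Qed.

Let qB x y z : q (x - y) z = q x z - q y z.
Proof. by rewrite qD -scaleN1r qZ mulN1r. Qed.

(** If [x] is outside the span of [s], then [v] is its normalized residual. Otherwise infinite
    dimension gives some vector outside the span, whose normalized residual serves with coefficient
    0, so the process never stops. *)
Let gs_step (s : seq H) x :
  (forall i j, (i < size s)%N -> (j < size s)%N -> q s`_i s`_j = (i == j)%:R) ->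
  exists v, [/\ q v v = 1, forall j, (j < size s)%N -> q v s`_j = 0 &
    x = \sum_(j < size s) q x s`_j *: s`_j + q x v *: v].
Proof.
move=> sON.
pose res y := y - \sum_(j < size s) q y s`_j *: s`_j.
have resj y j : (j < size s)%N -> q (res y) s`_j = 0.
  move=> js; rewrite /res qB q_sum (bigD1 (Ordinal js))//= qZ sON// eqxx mulr1.
  rewrite big1 ?addr0 ?subrr// => i ij.
  by rewrite qZ sON// -val_eqE/= in ij *; rewrite (negPf ij) mulr0.
have unit y : res y != 0 -> exists2 v, q v v = 1 /\
    (forall j, (j < size s)%N -> q v s`_j = 0) & exists c, res y = c *: v.
  move=> /[dup] r0 /q_gt0 qr.
  pose c := sqrtc (q (res y) (res y)).
  have c0 : c != 0 by rewrite sqrtc_eq0 gt_eqF.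
  have cc : c^* = c.
    have /ger0_Im : 0 <= c by rewrite sqrtc_ge0 ltW.
    by case: (c) => p t /= ->; rewrite oppr0.
  exists (c^-1 *: res y).
    split=> [|j js]; last by rewrite qZ resj// mulr0.
    rewrite qZ qZr conjc_inv cc -[q _ _]sqr_sqrtc -/c expr2.
    by field.
  by exists c; rewrite scalerA divff// scale1r.
have [r0|/unit[v [v1 vs] [c rc]]] := eqVneq (res x) 0; last first.
  exists v; split=> //; suff -> : q x v = c.
    by rewrite -rc /res addrC subrK.
  have -> : x = \sum_(j < size s) q x s`_j *: s`_j + c *: v.
    by rewrite -rc /res addrC subrK.
  rewrite qD qZ v1 mulr1 q_sum big1 ?add0r// => i _.
  by rewrite qZ (qC v) vs// conjc0 mulr0.
have [y y0] : exists y, res y != 0.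
  apply: contrapT => /forallNP yr; apply: Hinf.
  exists (size s), (fun i => s`_i) => y; exists (fun i => q y s`_i).
  by apply/eqP; rewrite -subr_eq0; apply/negPn/negP; exact: yr.
have [v [v1 vs] _] := unit _ y0.
exists v; split=> //; suff -> : q x v = 0.
  by rewrite scale0r addr0; apply/eqP; rewrite -subr_eq0; exact/eqP.
have -> : x = \sum_(j < size s) q x s`_j *: s`_j.
  by apply/eqP; rewrite -subr_eq0; exact/eqP.
by rewrite q_sum big1// => i _; rewrite qZ (qC v) vs// conjc0 mulr0.
Qed.

Lemma gram_schmidt (x : nat -> H) : exists b : nat -> H,
  (forall i j, q (b i) (b j) = (i == j)%:R) /\
  (forall n, x n = \sum_(j < n.+1) q (x n) (b j) *: b j).
Proof.
(* Orthonormality of [s] is put under the existential so that choice yields a total function of the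
   list and the vector. *)
have step s y : exists v,
    (forall i j, (i < size s)%N -> (j < size s)%N -> q s`_i s`_j = (i == j)%:R) ->
    [/\ q v v = 1, forall j, (j < size s)%N -> q v s`_j = 0 &
    y = \sum_(j < size s) q y s`_j *: s`_j + q y v *: v].
  have [sON|?] := pselect (forall i j, (i < size s)%N -> (j < size s)%N ->
    q s`_i s`_j = (i == j)%:R); last by exists 0.
  by have [v vP] := @gs_step s y sON; exists v.
have [v vP] := choice (fun sy : seq H * H => step sy.1 sy.2).
pose L := fix L n := if n is m.+1 then rcons (L m) (v (L m, x m)) else [::].
pose b n := v (L n, x n).
have LE n : L n = mkseq b n by elim: n => [//|n IH]; rewrite mkseqS -IH.
have bP n : (forall i j, (i < n)%N -> (j < n)%N -> q (b i) (b j) = (i == j)%:R) ->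
    [/\ q (b n) (b n) = 1, forall j, (j < n)%N -> q (b n) (b j) = 0 &
    x n = \sum_(j < n) q (x n) (b j) *: b j + q (x n) (b n) *: b n].
  move=> bON; have /= := vP (L n, x n); rewrite -/(b n) LE size_mkseq.
  case=> [i j lin ljn|b1 bn xE]; first by rewrite !nth_mkseq// bON.
  split=> // [j ljn|]; first by have := bn j ljn; rewrite nth_mkseq.
  rewrite {1}xE; congr (_ + _).
  by apply: eq_bigr => i _; rewrite nth_mkseq.
have bON n i j : (i < n)%N -> (j < n)%N -> q (b i) (b j) = (i == j)%:R.
  elim: n i j => [//|n IH] i j; have [b1 bn _] := bP n IH.
  rewrite ltnS leq_eqVlt => /orP[/eqP->|lin];
    rewrite ltnS leq_eqVlt => /orP[/eqP->|ljn].
  - by rewrite eqxx.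
  - by rewrite bn// gtn_eqF.
  - by rewrite qC bn// conjc0 ltn_eqF.
  - exact: IH.
exists b; split=> [i j|n].
  by apply: (bON (maxn i j).+1); rewrite ltnS ?leq_maxl ?leq_maxr.
by have [_ _ xE] := bP n (bON n); rewrite big_ord_recr.
Qed.

(** The coordinates in the Gram-Schmidt basis factor the Gram matrix. Since [x n] involves only the
    first n + 1 basis vectors, all sums can be extended to length [L]. *)
Lemma gram_factor (x : nat -> H) L : exists h : H -> nat -> R[i],
  forall m n, (m < L)%N -> (n < L)%N ->
  q (x m) (x n) = \sum_(j < L) h (x m) j * (h (x n) j)^*.
Proof.
have [b [bON xE]] := gram_schmidt x.
exists (fun y j => q y (b j)) => m n _ nL.
have xn j : (n < j)%N -> q (x n) (b j) = 0.
  move=> nj; rewrite xE q_sum big1// => i _; rewrite qZ bON.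
  by rewrite (ltn_eqF (leq_ltn_trans (leq_ord i) nj)) mulr0.
rewrite {1}(xE n) qC q_sum rmorph_sum/=.
rewrite (big_ord_widen L (fun j => (q (q (x n) (b j) *: b j) (x m))^*))//.
rewrite big_mkcond/=; apply: eq_bigr => j _; rewrite ltnS; case: leqP => jn.
  by rewrite qZ rmorphM/= mulrC -(qC (b j) (x m)).
by rewrite xn// conjc0 mulr0.
Qed.

End GramSchmidt.

(** * Orthonormal bases and operators determined on them *)

Section Basis.
Context {R : realType} {H : hilbertType R}.
Implicit Types (x y z : H) (a : R[i]) (S T U V : boundedOp H).

Local Notation "'<[' x , y ]>" := (inner x y).

Lemma nr_small (W : normedZmodType R[i]) (v : W) :
  (forall e : R, 0 < e -> nr v < e) -> v = 0.
Proof.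
move=> v0; have [//|/nr_gt0 /v0] := eqVneq v 0.
by rewrite ltxx.
Qed.

Definition hbasis (e : nat -> H) : Prop :=
  (forall i j, <[e i, e j]> = (i == j)%:R) /\
  (forall x (eps : R), 0 < eps -> exists n (c : nat -> R[i]),
     nr (x - \sum_(i < n) c i *: e i) < eps).

(** Gram-Schmidt is applied to a dense sequence, each term of which lies in the span of finitely
    many [e j]. *)
Lemma hbasis_exists : separable H -> ~ finite_dimensional H ->
  exists e : nat -> H, hbasis e.
Proof.
move=> [D Dc Ddense] Hinf.
have [g gD] : exists g : nat -> H, set_surj setT D g.
  exact: (elimT (@pcard_surjP H _ D setT) Dc).
have [e [eON ge]] := @gram_schmidt R H (@inner R H) (fun a x y z =>
  etrans (ipDl _ _ _) (congr1 (+%R^~ _) (ipZl _ _ _))) ipC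
  (@neq0_dnorm_gt0 _ _ _ (@inner R H)) Hinf g.
exists e; split=> // x eps eps0.
have [||y [xy Dy]] := Ddense (ball x eps%:C)°.
- by exists x; apply: nbhsx_ballx; rewrite ltcR.
- exact: open_interior.
have [n _ gn] := gD _ Dy.
exists n.+1, (fun j => <[g n, e j]>); rewrite -ge gn.
by have := interior_subset xy; rewrite -ball_normE/= nrE ltcR.
Qed.

Lemma ip_sum_sum n (f : nat -> H) (c d : nat -> R[i]) :
  (forall i j, <[f i, f j]> = (i == j)%:R) ->
  <[\sum_(i < n) c i *: f i, \sum_(i < n) d i *: f i]> = \sum_(i < n) c i * (d i)^*.
Proof.
move=> fON; rewrite ip_suml; apply: eq_bigr => i _.
rewrite ip_sumr (bigD1 i)//= big1 => [|j ji].
  by rewrite addr0 ipZl ipZr fON eqxx mulr1.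
by rewrite ipZl ipZr fON eq_sym (negPf ji : (_ == _ :> nat) = false) !mulr0.
Qed.

Lemma nr_sum_sqr n (f : nat -> H) (c : nat -> R[i]) :
  (forall i j, <[f i, f j]> = (i == j)%:R) ->
  nr (\sum_(i < n) c i *: f i) ^+ 2 = \sum_(i < n) nr (c i) ^+ 2.
Proof.
move=> fON; apply: complexI; rewrite -ip_nr ip_sum_sum// rmorph_sum/=.
apply: eq_bigr => i _; rewrite nr_sqr; case: (c i) => p t.
by apply/eqP; rewrite eq_complex/=; apply/andP; split; apply/eqP; ring.
Qed.

Lemma bessel n (f : nat -> H) x : (forall i j, <[f i, f j]> = (i == j)%:R) ->
  \sum_(i < n) nr (<[x, f i]>) ^+ 2 <= nr x ^+ 2.
Proof.
move=> fON; have := sqr_ge0 (nr (x - \sum_(i < n) <[x, f i]> *: f i)).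
rewrite nrB_sqr (nr_sum_sqr _ (fun i => <[x, f i]>))//.
suff -> : complex.Re <[x, \sum_(i < n) <[x, f i]> *: f i]> =
  \sum_(i < n) nr (<[x, f i]>) ^+ 2 by lra.
rewrite ip_sumr (_ : \sum_(i < n) _ = (\sum_(i < n) nr (<[x, f i]>) ^+ 2)%:C)//.
rewrite rmorph_sum/=; apply: eq_bigr => i _; rewrite ipZr nr_sqr.
case: (<[_, _]>) => p t.
by apply/eqP; rewrite eq_complex/=; apply/andP; split; apply/eqP; ring.
Qed.

Lemma op_lim (A : nat -> boundedOp H) : (forall n, contraction_op (A n)) ->
  (forall x (eps : R), 0 < eps ->
    exists N, forall n, (N <= n)%N -> nr (A n x - A N x) < eps) ->
  exists T, contraction_op T /\ forall x, A n x @[n --> \oo] --> T x.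
Proof.
move=> cA cauA.
have lA x : exists l : H, A n x @[n --> \oo] --> l.
  suff /cauchy_cvgP/cvg_ex : cauchy (A n x @[n --> \oo]) by [].
  apply: cauchy_exP => eps eps0.
  have eE : eps = (complex.Re eps)%:C by rewrite RRe_real// gtr0_real.
  have [|N AN] := cauA x (complex.Re eps); first by rewrite -ltcR -eE.
  exists (A N x); exists N => // n /= Nn.
  by rewrite -ball_normE/= nrE eE ltcR nrBC AN.
have [f fP] := choice lA.
have [a x y|x|T TE] := @op_exists _ _ f 1.
- apply: (nr_cvg_unique _ (fP _)).
  under eq_fun do rewrite linearP.
  by apply: cvgD (fP y); apply: cvgZr; exact: fP.
- rewrite mul1r; apply/ler_addgt0Pr => eps eps0.
  have /nr_cvgP/(_ _ eps0)[N _ /(_ N (leqnn N))/= h] := fP x.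
  rewrite -[f x](subrK (A N x)) (le_trans (nrD _ _))// addrC lerD//; last exact: ltW.
  by move/contractionP : (cA N); exact.
exists T; split=> [|x]; last by rewrite TE.
apply/contractionP => x; rewrite TE.
apply/ler_addgt0Pr => eps eps0.
have /nr_cvgP/(_ _ eps0)[N _ /(_ N (leqnn N))/= h] := fP x.
rewrite -[f x](subrK (A N x)) (le_trans (nrD _ _))// addrC lerD//; last exact: ltW.
by move/contractionP : (cA N); exact.
Qed.

Variable e : nat -> H.
Hypothesis eB : hbasis e.

(** The first three premises say that [P] defines a closed subspace, so it contains the closed span
    of the basis. *)
Lemma basis_ind (P : H -> Prop) : P 0 ->
  (forall a x y, P x -> P y -> P (a *: x + y)) ->
  (forall x, (forall eps : R, 0 < eps -> exists y, P y /\ nr (x - y) < eps) -> P x) ->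
  (forall n, P (e n)) -> forall x, P x.
Proof.
move=> P0 Plin Pcl Pe x; apply: Pcl => eps /(eB.2 x)[n [c xc]].
exists (\sum_(i < n) c i *: e i); split=> //.
elim: n {xc} => [|n IH]; first by rewrite big_ord0.
by rewrite big_ord_recr/= addrC; exact: Plin.
Qed.

Lemma basis_op_eq S T : contraction_op S -> contraction_op T ->
  (forall n, S (e n) = T (e n)) -> forall x, S x = T x.
Proof.
move=> /contractionP cS /contractionP cT.
apply: basis_ind => [|a x y Px Py|x Px]; first by rewrite !linear0.
  by rewrite !linearP Px Py.
apply/eqP; rewrite -subr_eq0; apply/eqP/nr_small => eps eps0.
have [y [ST xy]] := Px _ (divr_gt0 eps0 (ltr0n _ 2)).
rewrite (le_lt_trans (nr_tri (S y) _ _))//.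
have := cS (x - y); have := cT (y - x); rewrite !linearB ST (nrBC y x).
by move=> /= h1 h2; lra.
Qed.

Lemma basis_ip_eq S T S' T' : contraction_op S -> contraction_op T ->
  contraction_op S' -> contraction_op T' ->
  (forall i j, <[S (e i), T (e j)]> = <[S' (e i), T' (e j)]>) ->
  forall x y, <[S x, T y]> = <[S' x, T' y]>.
Proof.
move=> /contractionP cS /contractionP cT /contractionP cS' /contractionP cT' ST.
(* Induction in the first argument only; conjugate symmetry then transfers it to the second. *)
have half (U U' : boundedOp H) u u' : (forall x, nr (U x) <= nr x) ->
    (forall x, nr (U' x) <= nr x) ->
    (forall i, <[U (e i), u]> = <[U' (e i), u']>) ->
    forall x, <[U x, u]> = <[U' x, u']>.
  move=> cU cU'; apply: basis_ind => [|a x y Px Py|x Px].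
  - by rewrite !linear0 !ip0l.
  - by rewrite !linearP !ipDl !ipZl Px Py.
  - apply/eqP; rewrite -subr_eq0; apply/eqP/nr_small => eps eps0.
    have u0 : 0 < nr u + nr u' + 1 by rewrite ltr_wpDl ?addr_ge0 ?nr_ge0.
    have [y [Uy xy]] := Px _ (divr_gt0 eps0 u0).
    rewrite (le_lt_trans (nr_tri <[U y, u]> _ _))// -ipBl Uy -ipBl -!linearB.
    have h1 := cauchy_schwarz (U (x - y)) u.
    have h2 := cauchy_schwarz (U' (y - x)) u'.
    have h3 := cU (x - y); have h4 := cU' (y - x); rewrite (nrBC y x) in h4.
    rewrite ltr_pdivlMr// in xy.
    have := nr_ge0 u; have := nr_ge0 u'; have := nr_ge0 (x - y).
    by move=> /= ? ? ?; nra.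
move=> x y; move: x; apply: (half S S' (T y) (T' y)) => // i.
rewrite ipC [RHS]ipC; congr (_^*); move: y; apply: (half T T') => // j.
by rewrite ipC [RHS]ipC ST.
Qed.

Lemma basis_weak_cvg (A : nat -> boundedOp H) (l : R[i]) :
  (forall n, contraction_op (A n)) ->
  (forall i j, (fun n => <[A n (e i), e j]> : R[i]^o) @ \oo -->
     (l * <[e i, e j]> : R[i]^o)) ->
  forall x y, (fun n => <[A n x, y]> : R[i]^o) @ \oo --> (l * <[x, y]> : R[i]^o).
Proof.
move=> cA Ae.
have {}cA n x : nr (A n x) <= nr x by have /contractionP := cA n; exact.
have half x j : (fun n => <[A n x, e j]> : R[i]^o) @ \oo --> (l * <[x, e j]> : R[i]^o).
  move: x; apply: basis_ind => [|a x y Px Py|x Px|i]; last exact: Ae.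
  - by under eq_fun do rewrite linear0 ip0l; rewrite ip0l mulr0; exact: cvg_cst.
  - under eq_fun do rewrite linearP ipDl ipZl.
    rewrite ipDl ipZl mulrDr mulrCA.
    by apply: cvgD Py; apply: (@cvgZr _ (R[i]^o) _ _ _ _ _ _ Px).
  - apply/nr_cvgP => eps eps0.
    (* Replacing x by y costs at most (|l| + 1) |e j| |x - y|, uniformly in [n] as the [A n] are
       contractions; this divisor keeps the cost below eps / 2. *)
    have l0 : 0 < (nr l + 1) * (nr (e j) + 1) * 2.
      by rewrite !mulr_gt0// ltr_wpDl ?nr_ge0.
    have [y [/nr_cvgP Py]] := Px _ (divr_gt0 eps0 l0).
    rewrite ltr_pdivlMr// => xy.
    apply: filterS (Py _ (divr_gt0 eps0 (ltr0n _ 2))) => n /= yn.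
    have h1 := nr_tri (l * <[y, e j]>) (l * <[x, e j]>) <[A n x, e j]>.
    have h2 := nr_tri <[A n y, e j]> (l * <[y, e j]>) <[A n x, e j]>.
    move: h1 h2; rewrite -mulrBr -ipBl -ipBl -linearB nrM.
    have := cauchy_schwarz (x - y) (e j).
    have := cauchy_schwarz (A n (y - x)) (e j).
    have := cA n (y - x); rewrite (nrBC y x) => {Px Py Ae}.
    have := nr_ge0 l; have := nr_ge0 (e j); have := nr_ge0 (x - y) => /=.
    by move=> ? ? ? ? ? ? ? ?; nra.
move=> x; apply: basis_ind => [|a y z Py Pz|y Py|j]; last exact: half.
- by under eq_fun do rewrite ip0r; rewrite ip0r mulr0; exact: cvg_cst.
- under eq_fun do rewrite ipDr ipZr.
  rewrite ipDr ipZr mulrDr mulrCA.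
  by apply: cvgD Pz; apply: (@cvgZr _ (R[i]^o) _ _ _ _ _ _ Py).
- apply/nr_cvgP => eps eps0.
  have l0 : 0 < (nr l + 1) * (nr x + 1) * 2.
    by rewrite !mulr_gt0// ltr_wpDl ?nr_ge0.
  have [z [/nr_cvgP Pz]] := Py _ (divr_gt0 eps0 l0).
  rewrite ltr_pdivlMr// => yz.
  apply: filterS (Pz _ (divr_gt0 eps0 (ltr0n _ 2))) => n /= zn.
  have h1 := nr_tri (l * <[x, z]>) (l * <[x, y]>) <[A n x, y]>.
  have h2 := nr_tri <[A n x, z]> (l * <[x, z]>) <[A n x, y]>.
  move: h1 h2; rewrite -mulrBr -ipBr -ipBr nrM.
  have := cauchy_schwarz x (y - z).
  have := cauchy_schwarz (A n x) (z - y).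
  have := cA n x; rewrite (nrBC z y) => {Py Pz Ae half}.
  have := nr_ge0 l; have := nr_ge0 x; have := nr_ge0 (y - z) => /=.
  by move=> ? ? ? ? ? ? ? ?; nra.
Qed.

(** The operator is the strong limit of its finite-rank truncations, which are contractions by
    Bessel's inequality because the vectors [e (s i)] are orthonormal. *)
Lemma basis_map (s : nat -> nat) : injective s ->
  exists T, contraction_op T /\ forall n, T (e n) = e (s n).
Proof.
move=> sI.
have sON i j : <[e (s i), e (s j)]> = (i == j)%:R.
  by rewrite eB.1 (inj_eq sI).
have SE N : exists S : boundedOp H,
    forall x, S x = \sum_(i < N) <[x, e i]> *: e (s i).
  apply: (@op_exists _ _ _ 1) => [a x y|x].
    rewrite scaler_sumr -big_split; apply: eq_bigr => i _ /=.
    by rewrite ipDl ipZl scalerDl scalerA.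
  rewrite mul1r -(@ler_pXn2r _ 2) ?nnegrE ?nr_ge0//.
  rewrite (nr_sum_sqr _ (fun i => <[x, e i]>) sON).
  exact: bessel eB.1.
have [S {}SE] := choice SE.
have cS N : contraction_op (S N).
  apply/contractionP => x; rewrite -(@ler_pXn2r _ 2) ?nnegrE ?nr_ge0// SE.
  rewrite (nr_sum_sqr _ (fun i => <[x, e i]>) sON).
  exact: bessel eB.1.
have cS' N x : nr (S N x) <= nr x by have /contractionP := cS N; exact.
have Se N n : (n < N)%N -> S N (e n) = e (s n).
  move=> nN; rewrite SE (bigD1 (Ordinal nN))//= eB.1 eqxx scale1r big1 ?addr0// => i.
  by rewrite -val_eqE eB.1 eq_sym/= => /negPf ->; rewrite scale0r.
have [|T [cT TP]] := op_lim cS.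
  apply: basis_ind => [eps eps0|a x y Px Py eps eps0|x Px eps eps0|n eps eps0].
  - by exists 0%N => n _; rewrite !linear0 addr0 nr0.
  - have a0 : 0 < (nr a + 1) * 4 by rewrite mulr_gt0 ?ltr_wpDl ?nr_ge0.
    have [N1 PN1] := Px _ (divr_gt0 eps0 a0).
    have [N2 PN2] := Py _ (divr_gt0 eps0 (ltr0n _ 4)).
    exists (maxn N1 N2) => n; rewrite geq_max => /andP[n1 n2].
    have [m1 m2] := (leq_maxl N1 N2, leq_maxr N1 N2).
    rewrite (linearP (S n)) (linearP (S (maxn N1 N2))) opprD addrACA -scalerBr.
    rewrite (le_lt_trans (nrD _ _))// nrZ.
    have h1 := nr_tri (S N1 x) (S n x) (S (maxn N1 N2) x).
    have h2 := nr_tri (S N2 y) (S n y) (S (maxn N1 N2) y).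
    have := PN1 _ n1; have := PN1 _ m1; have := PN2 _ n2; have := PN2 _ m2.
    rewrite (nrBC (S N1 x)) in h1; rewrite (nrBC (S N2 y)) in h2.
    rewrite !ltr_pdivlMr// => ? ? ? ?; have := nr_ge0 a => ?; nra.
  - have [y [Py xy]] := Px _ (divr_gt0 eps0 (ltr0n _ 3)).
    have [N PN] := Py _ (divr_gt0 eps0 (ltr0n _ 3)).
    exists N => n /PN yn.
    have h1 := nr_tri (S n y) (S n x) (S N x).
    have h2 := nr_tri (S N y) (S n y) (S N x).
    have := cS' n (x - y); have := cS' N (y - x).
    rewrite !linearB (nrBC y) => /= ? ?; lra.
  - by exists n.+1 => m nm; rewrite !Se// subrr nr0.
exists T; split=> // n.
apply: (nr_cvg_unique _ (TP _)).
apply: cvg_near_cst; exists n.+1 => // m /= nm.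
by rewrite Se.
Qed.

End Basis.

(** * Means of roots of unity *)

Section UnitCircle.
Context {R : realType}.
Implicit Types (s t : R).

Definition expi (t : R) : R[i] := cos t +i* sin t.

Lemma expi0 : expi 0 = 1.
Proof. by rewrite /expi cos0 sin0. Qed.

Lemma expiD s t : expi (s + t) = expi s * expi t.
Proof.
rewrite /expi cosD sinD; apply/eqP; rewrite eq_complex/= eqxx/=.
by rewrite addrC.
Qed.

Lemma expiX t n : expi t ^+ n = expi (n%:R * t).
Proof.
elim: n => [|n IH]; first by rewrite expr0 mul0r expi0.
by rewrite exprS IH -expiD mulrS mulrDl mul1r.
Qed.

Lemma expi_conj t : (expi t)^* = expi (- t).
Proof. by rewrite /expi cosN sinN. Qed.

Lemma expi2pi n : expi (n%:R * (2 * pi)) = 1.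
Proof.
by rewrite -expiX /expi (mulr_natl _ 2) cos2pi sin2pi expr1n.
Qed.

Lemma nr_expi t : nr (expi t) = 1.
Proof.
by apply/eqP; rewrite -(@eqrXn2 _ 2) ?nr_ge0// nr_sqr/= cos2Dsin2 expr1n.
Qed.

Lemma norm_sin_le t : `|sin t| <= `|t|.
Proof.
wlog t0 : t / 0 <= t.
  move=> h; have [/h//|/ltW t0] := leP 0 t.
  by rewrite -normrN -sinN -(normrN t) h// oppr_ge0.
have [|c _] := @MVT_segment R sin cos 0 t t0 (fun x _ => is_derive_sin x).
  exact/continuous_subspaceT/continuous_sin.
rewrite sin0 !subr0 => ->; rewrite normrM ler_piMl//.
by rewrite ler_norml cos_geN1 cos_le1.
Qed.

Lemma nr_expiB1 t : nr (expi t - 1) <= `|t|.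
Proof.
rewrite -(@ler_pXn2r _ 2) ?nnegrE ?nr_ge0// nr_sqr/= subr0.
have -> : (cos t - 1) ^+ 2 + sin t ^+ 2 = (2 * sin (t / 2)) ^+ 2.
  have h1 := cos2Dsin2 t; have h2 := cos2Dsin2 (t / 2).
  have : cos t = cos (t / 2) ^+ 2 *+ 2 - 1.
    by rewrite -cos_mulr2n; congr cos; rewrite mulr2n; field.
  nra.
rewrite real_normK ?num_real// -(real_normK (num_real (2 * _))).
rewrite -(real_normK (num_real t)) ler_pXn2r ?nnegrE//.
rewrite normrM ger0_norm//; have := norm_sin_le (t / 2).
by rewrite normrM (ger0_norm (x := 2^-1))// ler_pdivlMr// mulrC.
Qed.

Lemma nr_expiB s t : nr (expi s - expi t) <= `|s - t|.
Proof.
rewrite -{1}(subrK t s) expiD -{2}(mul1r (expi t)) -mulrBl nrM nr_expi mulr1.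
exact: nr_expiB1.
Qed.

Lemma unit_expi (w : R[i]) : nr w = 1 ->
  exists t, [/\ 0 <= t, t <= 2 * pi & w = expi t].
Proof.
move=> w1; have := nr_sqr w; rewrite w1 expr1n => ri.
have c1 : -1 <= complex.Re w <= 1 by rewrite -ler_norml -w1 Re_le_nr.
have [a0 api] := (acos_ge0 c1, acos_lepi c1).
have ca : cos (acos (complex.Re w)) = complex.Re w by rewrite acosK.
have sa : sin (acos (complex.Re w)) = `|complex.Im w|.
  rewrite sin_acos// -sqrtr_sqr; congr Num.sqrt; rewrite ri; ring.
case: (leP 0 (complex.Im w)) => i0.
  exists (acos (complex.Re w)); split=> //; first by lra.
  by rewrite /expi ca sa ger0_norm//; case: (w).
exists (2 * pi - acos (complex.Re w)); split=> //; [lra|lra|].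
rewrite /expi (mulr_natl _ 2) cosB sinB cos2pi sin2pi ca sa ltr0_norm//.
by case: (w) => p q /=; apply/eqP; rewrite eq_complex/=; apply/andP; split;
  apply/eqP; ring.
Qed.

(** Write l = |l| u with |u| = 1 and |l| = cos c; then l is the mean of u exp(i c) and u exp(- i
    c). *)
Lemma disk_mean (l : R[i]) : nr l <= 1 -> exists s t,
  [/\ 0 <= s <= 2 * pi, 0 <= t <= 2 * pi & l = (expi s + expi t) / 2].
Proof.
move=> l1.
have [u [u1 lu]] : exists u : R[i], nr u = 1 /\ l = (nr l)%:C * u.
  have [->|l0] := eqVneq l 0; first by exists 1; rewrite nr1 nr0 mul0r.
  have nl0 : nr l != 0 by rewrite gt_eqF// nr_gt0.
  exists ((nr l)^-1%:C * l); split.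
    by rewrite nrM nr_real ger0_norm ?invr_ge0 ?nr_ge0// mulVf.
  by rewrite mulrA -rmorphM/= divff// mul1r.
have c1 : -1 <= nr l <= 1 by rewrite l1 andbT (le_trans _ (nr_ge0 l))// lerN10.
pose c := acos (nr l); have cE : cos c = nr l by rewrite /c acosK.
have [|s [s0 s2 sE]] := unit_expi (w := u * expi c); first by rewrite nrM u1 nr_expi mulr1.
have [|t [t0 t2 tE]] := unit_expi (w := u * expi (- c)).
  by rewrite nrM u1 nr_expi mulr1.
exists s, t; rewrite s0 t0 s2 t2; split=> //.
rewrite -sE -tE -mulrDr {1}lu -cE /expi cosN sinN.
have -> : (cos c +i* sin c) + (cos c +i* - sin c) = (cos c)%:C * 2 :> R[i].
  by apply/eqP; rewrite eq_complex/=; apply/andP; split; apply/eqP; ring.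
by rewrite mulrA mulfK ?pnatr_eq0// mulrC.
Qed.

(** Rounding down to the grid of mesh 2 pi / p works for every large [p], so two angles can share
    one denominator. *)
Lemma angle_approx t (eps : R) : 0 <= t <= 2 * pi -> 0 < eps ->
  exists P : nat, forall p, (P < p)%N -> exists a, (a <= p)%N /\
    `|a%:R / p%:R * (2 * pi) - t| < eps.
Proof.
move=> /andP[t0 t2] eps0; have pi2 : 0 < 2 * pi :> R by rewrite mulr_gt0 ?pi_gt0.
exists (Num.truncn (2 * pi / eps)) => p.
rewrite -ltnS -ltnS ltnS => Pp.
have {}Pp : 2 * pi / eps < p%:R by rewrite (lt_le_trans (truncnS_gt _))// ler_nat.
have p0 : 0 < p%:R :> R by rewrite (lt_trans _ Pp)// divr_gt0.
have x0 : 0 <= t / (2 * pi) * p%:R by rewrite !mulr_ge0// ?invr_ge0 ltW.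
have /andP[a1 a2] := truncn_itv x0; rewrite -addn1 natrD in a2.
set a := Num.truncn _ in a1 a2 *.
exists a; split.
  rewrite -(ler_nat R) (le_trans a1)// ler_piMl ?ler_pdivrMr ?mul1r//; exact: ltW.
have tE : t = t / (2 * pi) * p%:R / p%:R * (2 * pi).
  by rewrite mulfK ?gt_eqF// divfK ?gt_eqF.
rewrite {1}tE -mulrBl -mulrBl normrM (gtr0_norm pi2) normrM normfV (gtr0_norm p0).
rewrite mulrAC ltr_pdivrMr//.
rewrite ltr_pdivrMr// in Pp; rewrite [ltRHS]mulrC; apply: le_lt_trans Pp.
rewrite ler_piMl ?(ltW pi2)// ler_norml; apply/andP.
by move: (t / _ * _) a1 a2 => x a1 a2; split; lra.
Qed.

(* The targets [l_k] are the means of [expi (s k)] and [expi (t k)]. *)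
Lemma disk_targets : exists (s t : nat -> R) (p : nat -> nat),
  [/\ forall k, (0 < p k)%N,
      forall k, (0 <= s k <= 2 * pi) /\ (0 <= t k <= 2 * pi),
      forall k, expi ((p k)%:R * s k) = 1 /\ expi ((p k)%:R * t k) = 1 &
      forall (l : R[i]) (eps : R) N, nr l <= 1 -> 0 < eps ->
        exists k, (N <= k)%N /\ nr ((expi (s k) + expi (t k)) / 2 - l) < eps].
Proof.
have pi2 : 0 < 2 * pi :> R by rewrite mulr_gt0 ?pi_gt0.
(* The index [k] codes a denominator (minus one), two numerators and a dummy entry; the dummy makes
   every target recur at arbitrarily large [k]. Reduction modulo [(p k).+1] keeps the numerators at
   most [p k]. *)
pose D k := odflt (0, 0, 0, 0)%N (unpickle k : option (nat * nat * nat * nat)).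
pose p k := (D k).1.1.1.+1.
pose s k : R := ((D k).1.1.2 %% (p k).+1)%:R / (p k)%:R * (2 * pi).
pose t k : R := ((D k).1.2 %% (p k).+1)%:R / (p k)%:R * (2 * pi).
have itv (a q : nat) : 0 <= ((a %% q.+2)%:R / q.+1%:R * (2 * pi) : R) <= 2 * pi.
  rewrite mulr_ge0 ?divr_ge0 ?(ltW pi2)//= ler_piMl ?(ltW pi2)//.
  by rewrite ler_pdivrMr// mul1r ler_nat -ltnS ltn_pmod.
have one (a q : nat) : expi (q.+1%:R * (a%:R / q.+1%:R * (2 * pi))) = 1.
  by rewrite mulrA [_ * (_ / _)]mulrC divfK ?pnatr_eq0// expi2pi.
exists s, t, p; split=> // [k|k|l eps N /disk_mean[u [v [u2 v2 ->]]] eps0].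
- by rewrite /s /t /p; split; exact: itv.
- by rewrite /s /t /p !one.
have [P1 uP] := angle_approx u2 eps0; have [P2 vP] := angle_approx v2 eps0.
pose q := (maxn P1 P2).+1.
have [a [aq ua]] : exists a, (a <= q)%N /\ `|a%:R / q%:R * (2 * pi) - u| < eps.
  by apply: uP; rewrite ltnS leq_maxl.
have [b [bq vb]] : exists a, (a <= q)%N /\ `|a%:R / q%:R * (2 * pi) - v| < eps.
  by apply: vP; rewrite ltnS leq_maxr.
pose f (j : nat) := pickle (maxn P1 P2, a, b, j)%N.
have [j Nj] : exists j, (N <= f j)%N.
  apply: contrapT => /forallNP fN.
  have fI : injective f by move=> i j /(pcan_inj pickleK)[].
  have /(uniq_leq_size _) : {subset map f (iota 0 N.+1) <= iota 0 N}.
    move=> _ /mapP[i _ ->]; rewrite mem_iota/= add0n ltnNge.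
    by apply/negP; exact: fN.
  by rewrite map_inj_uniq// iota_uniq size_map !size_iota ltnn => /(_ isT).
exists (f j); split=> //.
have DE : D (f j) = (maxn P1 P2, a, b, j)%N by rewrite /D /f pickleK.
rewrite /s /t /p DE/= -/q !modn_small ?ltnS//.
rewrite -mulrBl nrM opprD addrACA.
rewrite nr_half.
rewrite ltr_pdivrMr// (le_lt_trans (nrD _ _))//.
have := nr_expiB (a%:R / q%:R * (2 * pi)) u.
have := nr_expiB (b%:R / q%:R * (2 * pi)) v; lra.
Qed.

End UnitCircle.

(** * Operator topologies *)

Lemma initial_ptws_cvgP (S : choiceType) (U : topologicalType) (V : uniformType)
    (g : S -> U -> V) T (F : set_system T) (f : T -> S) (s : S) : Filter F ->
  f @ F --> (s : initial_topology (g : S -> {ptws U -> V})) <->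
  forall u, g (f t) u @[t --> F] --> g s u.
Proof.
move=> FF; split=> [fs u|gfs].
  have gc : (g : initial_topology (g : S -> {ptws U -> V}) -> {ptws U -> V}) @
      nbhs (s : initial_topology (g : S -> {ptws U -> V})) --> (g s : {ptws U -> V}).
    exact: initial_continuous.
  have /(_ _) h := cvg_comp _ _ fs gc.
  have /pointwise_cvgP/(_ u) := h.
  exact.
move=> A [B [[C oC <-] Cs] BA].
have gs : (fun t => (g (f t) : {ptws U -> V})) @ F --> (g s : {ptws U -> V}).
  by apply/pointwise_cvgP => u; exact: gfs.
have h : F ((fun t => (g (f t) : {ptws U -> V})) @^-1` C).
  by apply: gs; exact: open_nbhs_nbhs.
by apply: (@filterS _ F FF ((fun t => g (f t)) @^-1` C)) h => t Ct; exact: (BA (f t)).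
Qed.

Section OperatorTopologies.
Context {R : realType} {H : hilbertType R}.

Lemma WOT_cvgP T (F : set_system T) (f : T -> boundedOp H) (S : boundedOp H) :
  Filter F -> (f : T -> WOT H) @ F --> (S : WOT H) <->
  forall x y, (fun t => inner (f t x) y : R[i]^o) @ F --> (inner (S x) y : R[i]^o).
Proof.
move=> FF; rewrite initial_ptws_cvgP; split=> h; last by case=> x y; exact: h.
by move=> x y; exact: (h (x, y)).
Qed.

Lemma SOT_cvgP T (F : set_system T) (f : T -> boundedOp H) (S : boundedOp H) :
  Filter F -> (f : T -> SOT H) @ F --> (S : SOT H) <->
  forall x, f t x @[t --> F] --> S x.
Proof. by move=> FF; rewrite initial_ptws_cvgP. Qed.

Lemma SOTstar_cvgP T (F : set_system T) (f : T -> boundedOp H) (S : boundedOp H) :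
  Filter F -> (f : T -> SOTstar H) @ F --> (S : SOTstar H) <->
  forall x, f t x @[t --> F] --> S x /\
    adjoint (f t) x @[t --> F] --> adjoint S x.
Proof.
move=> FF; rewrite initial_ptws_cvgP; split=> h x; last first.
  by have [h1 h2] := h x; exact: cvg_pair.
split; first exact: (cvg_comp _ _ (h x) cvg_fst).
exact: (cvg_comp _ _ (h x) cvg_snd).
Qed.

End OperatorTopologies.

(** * Increasing exponents and a criterion for disk-rigidity *)

Lemma increasing_choice (P : nat -> nat -> Prop) :
  (forall j N, exists k, (N <= k)%N /\ P j k) ->
  exists n : nat -> nat, {homo n : j k / (j < k)%N} /\ forall j, P j (n j).
Proof.
move=> Pk; have [g gP] := choice (fun jN : nat * nat => Pk jN.1 jN.2).
pose n := fix n j := if j is i.+1 then g (j, (n i).+1) else g (0, 0)%N.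
exists n; split=> [|[|j]]; last 2 first.
- exact: (gP (0, 0)%N).2.
- exact: (gP (j.+1, (n j).+1)%N).2.
apply: homo_ltn => [|j]; first exact: ltn_trans.
exact: (gP (j.+1, (n j).+1)%N).1.
Qed.

Lemma disk_rigid_crit {R : realType} {H : hilbertType R} (T : boundedOp H) :
  (forall (l : R[i]), nr l <= 1 -> exists n : nat -> nat,
    {homo n : j k / (j < k)%N} /\ forall x y,
      (fun k => inner (pow_op T (n k) x) y : R[i]^o) @ \oo -->
        (l * inner x y : R[i]^o)) -> disk_rigid T.
Proof.
move=> Tr l l1; have [|n [ni nl]] := Tr l; first by rewrite -lecR -nrE.
exists n; split=> //; apply/WOT_cvgP => x y.
by rewrite scalar_opE ipZl; exact: nl.
Qed.

Lemma disk_rigid_pow {R : realType} {H : hilbertType R} (T : boundedOp H) (l : R[i]) :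
  disk_rigid T -> nr l <= 1 -> exists n : nat -> nat,
    {homo n : j k / (j < k)%N} /\ forall x y,
      (fun k => inner (pow_op T (n k) x) y : R[i]^o) @ \oo -->
        (l * inner x y : R[i]^o).
Proof.
move=> Tr l1; have [|n [ni /WOT_cvgP nl]] := Tr l; first by rewrite nrE lecR.
exists n; split=> [|x y]; first exact: ni.
rewrite -ipZl.
rewrite -scalar_opE.
exact: nl.
Qed.

(** * Perturbation to a disk-rigid unitary *)

Section Limits.
Context {R : realType} {H : hilbertType R}.
Implicit Types (x y z : H) (S T U V : boundedOp H).

(** Each further power adds one error, since S^(n+1) - T^(n+1) = S (S^n - T^n) + (S - T) T^n. *)
Lemma pow_op_close S T (eps : R) : contraction_op S -> contraction_op T ->
  (forall x, nr (S x - T x) <= eps * nr x) ->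
  forall n x, nr (pow_op S n x - pow_op T n x) <= n%:R * eps * nr x.
Proof.
move=> /contractionP cS cT ST n x.
have eps0 : 0 <= eps * nr x by apply: le_trans (ST x); exact: nr_ge0.
elim: n => [|n IH]; first by rewrite !scalar1E subrr nr0 !mul0r.
rewrite !pow_opS (le_trans (nr_tri (S (pow_op T n x)) _ _))// -linearB.
have := cS (pow_op S n x - pow_op T n x).
have := ST (pow_op T n x).
have /contractionP/(_ x) := contraction_pow n cT.
rewrite -natr1 !mulrDl mul1r -mulrA => h1 h2 h3.
apply: lerD; first by rewrite (le_trans h3)// mulrA.
apply: (le_trans h2); have [x0|x0] := eqVneq (nr x) 0.
  have /nr0_eq0 x00 := x0; rewrite x0 mulr0 x00.
  have -> : pow_op T n 0 = 0 by rewrite linear0.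
  by rewrite nr0 mulr0.
apply: ler_wpM2l => //; move: eps0; rewrite pmulr_lge0// lt_neqAle eq_sym x0.
exact: nr_ge0.
Qed.

Lemma geometric_lim (A : nat -> boundedOp H) (d : nat -> R) :
  (forall k, contraction_op (A k)) -> (forall k, 0 <= d k) ->
  (forall k, d k.+1 <= d k / 2) -> (forall eps, 0 < eps -> exists k, d k < eps) ->
  (forall k x, nr (A k.+1 x - A k x) <= d k * nr x) ->
  exists T, contraction_op T /\ forall k x, nr (T x - A k x) <= 2 * d k * nr x.
Proof.
move=> cA d0 d2 dlim Ad.
(* The subtracted term makes the induction close: halving gives d k <= 2 d k - 2 d (k + 1). *)
have Akm k i x : nr (A (k + i)%N x - A k x) <= (2 * d k - 2 * d (k + i)%N) * nr x.
  elim: i => [|i IH]; first by rewrite addn0 !subrr nr0 mul0r.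
  rewrite addnS (le_trans (nr_tri (A (k + i)%N x) _ _))//.
  have := Ad (k + i)%N x; have := d2 (k + i)%N; have := nr_ge0 x.
  move=> ? ? ?; nra.
have Ak k m x : (k <= m)%N -> nr (A m x - A k x) <= 2 * d k * nr x.
  move=> km; rewrite -(subnKC km) (le_trans (Akm _ _ _))// ler_wpM2r ?nr_ge0//.
  by rewrite gerBl mulr_ge0.
have [|T [cT TP]] := op_lim cA.
  move=> x eps eps0.
  have x0 : 0 < 2 * (nr x + 1) by rewrite mulr_gt0// ltr_wpDl ?nr_ge0.
  have [k] := dlim _ (divr_gt0 eps0 x0); rewrite ltr_pdivlMr// => dk.
  exists k => n kn; rewrite (le_lt_trans (Ak _ _ _ kn))//.
  by have := d0 k; have := nr_ge0 x => ? ?; nra.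
exists T; split=> // k x.
apply/ler_addgt0Pr => eps eps0.
have /nr_cvgP/(_ _ eps0)[N _ /(_ (maxn N k) (leq_maxl _ _))/= h] := TP x.
rewrite (le_trans (nr_tri (A (maxn N k) x) _ _))// addrC lerD ?Ak ?leq_maxr//.
exact: ltW.
Qed.

End Limits.

Section Perturbation.
Context {R : realType} {H : hilbertType R}.
Implicit Types (x y : H) (S T U : boundedOp H).

Local Notation "'<[' x , y ]>" := (inner x y).

(* [x + S x] and [x - S x] are orthogonal, and the operator multiplies them by
   [z] and [w]. *)
Lemma involution_comb S (z w : R[i]) (C : R) x : contraction_op S ->
  (forall x, S (S x) = x) -> nr z <= C -> nr w <= C ->
  nr (((z + w) / 2) *: x + ((z - w) / 2) *: S x) <= C * nr x.
Proof.
move=> cS SS zC wC.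
have C0 : 0 <= C by apply: le_trans zC; exact: nr_ge0.
have SU : unitary_pair S S by split.
pose p := x + S x; pose m := x - S x.
have -> : ((z + w) / 2) *: x + ((z - w) / 2) *: S x = (z / 2) *: p + (w / 2) *: m.
  rewrite /p /m !scalerDr !scalerN addrACA -!scalerDl -scalerBl.
  by congr (_ *: _ + _ *: _); ring.
have pm : complex.Re <[(z / 2) *: p, (w / 2) *: m]> = 0.
  rewrite ipZl ipZr ipDl !ipBr (unitary_pair_ip x x SU) (unitary_pair_ip x (S x) SU) SS.
  by rewrite addrA subrK subrr !mulr0.
rewrite -(@ler_pXn2r _ 2) ?nnegrE ?mulr_ge0 ?nr_ge0// nrD_sqr pm mulr0 addr0.
have n2 (v : R[i]) : nr (v / 2) = nr v / 2 by rewrite nrM nr_half.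
rewrite !nrZ !n2 !exprMn.
have pmx : nr p ^+ 2 + nr m ^+ 2 = 4 * nr x ^+ 2.
  by rewrite /p /m nrD_sqr nrB_sqr (unitary_pair_nr _ SU); ring.
have z2 : nr z ^+ 2 <= C ^+ 2 by rewrite ler_pXn2r ?nnegrE ?nr_ge0.
have w2 : nr w ^+ 2 <= C ^+ 2 by rewrite ler_pXn2r ?nnegrE ?nr_ge0.
have := sqr_ge0 (nr p); have := sqr_ge0 (nr m) => m0 p0.
have := ler_wpM2r p0 z2; have := ler_wpM2r m0 w2 => h1 h2.
have -> : C ^+ 2 * nr x ^+ 2 = C ^+ 2 * (nr p ^+ 2 + nr m ^+ 2) / 4.
  by rewrite pmx; field.
by move: h1 h2; rewrite !expr2; lra.
Qed.

Variables (V : boundedOp H) (M : nat) (S : nat -> boundedOp H).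
Hypotheses (M0 : (0 < M)%N) (cV : contraction_op V)
  (VM : forall x, pow_op V M x = x)
  (cS : forall k, contraction_op (S k)) (SS : forall k x, S k (S k x) = x)
  (SC : forall j k x, S j (S k x) = S k (S j x))
  (SV : forall k x, S k (V x) = V (S k x))
  (Sw : forall x y, (fun k => <[S k x, y]> : R[i]^o) @ \oo --> (0 : R[i]^o)).

(** This operator acts as [z] and [w] on the eigenspaces of [S k] for 1 and -1, so products of such
    operators multiply the parameters separately. *)
Let comb_op k (z w : R[i]) : exists D : boundedOp H,
  forall x, D x = ((z + w) / 2) *: x + ((z - w) / 2) *: S k x.
Proof.
apply: (@op_exists _ _ _ (Num.max (nr z) (nr w))) => [a x y|x].
  by rewrite (linearP (S k)) !scalerDr !scalerA addrACA !(mulrC a).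
by apply: involution_comb => //; rewrite le_max lexx ?orbT.
Qed.

Lemma disk_rigid_perturb (eps : R) : 0 < eps ->
  exists W W', [/\ unitary_pair W W', disk_rigid W &
    forall x, nr (W x - V x) <= eps * nr x].
Proof.
move=> eps0.
have [s [t [p [p0 st0 pst dense_st]]]] := @disk_targets R.
have [D' DP'] := choice (fun kzw : nat * R[i] * R[i] => comb_op kzw.1.1 kzw.1.2 kzw.2).
pose D k z w := D' (k, z, w).
have DP k z w x : D k z w x = ((z + w) / 2) *: x + ((z - w) / 2) *: S k x by exact: DP'.
have DM k z w z' w' x : D k z w (D k z' w' x) = D k (z * z') (w * w') x.
  rewrite !DP (linearD (S k)) !opZ SS !scalerDr !scalerA [X in _ + X]addrC addrACA.
  by rewrite -!scalerDl; congr (_ *: _ + _ *: _); field.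
have D1 k x : D k 1 1 x = x.
  rewrite DP subrr mul0r scale0r addr0 (_ : (1 + 1) / 2 = 1) ?scale1r//.
  by field.
have DX k z w n x : pow_op (D k z w) n x = D k (z ^+ n) (w ^+ n) x.
  elim: n => [|n IH]; first by rewrite scalar1E D1.
  by rewrite pow_opS IH DM -!exprS.
have cD k z w : nr z <= 1 -> nr w <= 1 -> contraction_op (D k z w).
  move=> z1 w1; apply/contractionP => x; rewrite DP -[leRHS]mul1r.
  exact: involution_comb.
have Dcomm k z w (T : boundedOp H) x : (forall x, S k (T x) = T (S k x)) ->
    D k z w (T x) = T (D k z w x).
  by move=> ST; rewrite !DP linearD !linearZ/= ST.
have pi2 : 0 < 2 * pi :> R by rewrite mulr_gt0 ?pi_gt0.
pose c : R := 2 * pi.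
(* Chosen so that 2 c / n 0 <= eps, which bounds the total distance from [W] to [V]. *)
pose K := (Num.truncn (2 * c / eps)).+1.
(* The factor [M] makes [V] trivial at these powers, [p j] does so for the j-th perturbing factor at
   all later exponents, and [j.+2] makes the next perturbation negligible at exponent n j. *)
pose n := fix n k := if k is j.+1 then (n j * (p j * j.+2))%N else (M * K)%N.
have n_gt0 k : (0 < n k)%N.
  by elim: k => [|k IH] /=; rewrite !muln_gt0 ?M0//= IH p0.
have n_inc : {homo n : j k / (j < k)%N}.
  apply: homo_ltn => [|k /=]; first exact: ltn_trans.
  by rewrite ltn_Pmulr// (leq_trans _ (leq_pmull _ (p0 k))).
have n_ge k : (k < n k)%N.
  by elim: k => // k IH; rewrite (leq_ltn_trans IH)// n_inc.
(* These are n k-th roots of the two points whose mean is the target, within c / n k of 1. *)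
pose z k := expi (s k / (n k)%:R); pose w k := expi (t k / (n k)%:R).
have nn0 k : (n k)%:R != 0 :> R by rewrite pnatr_eq0 -lt0n.
have n0 k : 0 < (n k)%:R :> R by rewrite ltr0n.
have zn k : z k ^+ n k = expi (s k) by rewrite expiX mulrC divfK.
have wn k : w k ^+ n k = expi (t k) by rewrite expiX mulrC divfK.
pose d k := c / (n k)%:R.
have d0 k : 0 <= d k by rewrite divr_ge0// ltW.
have dS k : d k.+1 <= d k / k.+2%:R.
  rewrite /d -mulrA -invfM ler_pM2l// lef_pV2 ?posrE ?mulr_gt0// -natrM ler_nat/=.
  by rewrite leq_mul2l leq_pmull ?p0 ?orbT.
have d2 k : d k.+1 <= d k / 2.
  by rewrite (le_trans (dS k))// ler_wpM2l// lef_pV2 ?posrE// ler_nat.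
have dlim e : 0 < e -> exists k, d k < e.
  move=> e0; exists (Num.truncn (c / e)).
  rewrite /d ltr_pdivrMr// mulrC -ltr_pdivrMr//.
  by rewrite (lt_le_trans (truncnS_gt _))// ler_nat n_ge.
pose U k := D k (z k) (w k); pose U' k := D k (z k)^* (w k)^*.
have UU k : unitary_pair (U k) (U' k).
  have e1 (a : R) : expi a * expi (- a) = 1 :> R[i] by rewrite -expiD subrr expi0.
  split; try by apply: cD; rewrite ?nr_conj nr_expi.
    by move=> x; rewrite DM /z /w !expi_conj mulrC e1 mulrC e1 D1.
  by move=> x; rewrite DM /z /w !expi_conj !e1 D1.
have zd k (a : R) : 0 <= a <= c -> nr (expi (a / (n k)%:R) - 1) <= d k.
  move=> /andP[a0 ac]; rewrite (le_trans (nr_expiB1 _))// ger0_norm ?divr_ge0//.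
  by rewrite ler_pM2r ?invr_gt0.
have zd' k (a : R) : 0 <= a <= c -> nr ((expi (a / (n k)%:R))^* - 1) <= d k.
  by move=> /(zd k); rewrite -(nr_conj (_ - 1)) rmorphB rmorph1.
have D1d k a b x : nr (a - 1) <= d k -> nr (b - 1) <= d k ->
    nr (D k a b x - x) <= d k * nr x.
  move=> ad bd; have := involution_comb x (cS k) (SS k) ad bd.
  have -> : D k a b x - x = ((a - 1 + (b - 1)) / 2) *: x + ((a - 1 - (b - 1)) / 2) *: S k x.
    rewrite DP addrAC -{2}(scale1r x) -scalerBl; congr (_ *: _ + _ *: _).
      by field.
    by rewrite opprB addrA subrK.
  by [].
have Ud k x : nr (U k x - x) <= d k * nr x by apply: D1d; apply: zd; apply st0.
have Ud' k x : nr (U' k x - x) <= d k * nr x by apply: D1d; apply: zd'; apply st0.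
(* [A k] is V times U 0, .., U (k - 1), and [B k] its inverse, starting from V^(M-1). *)
pose A := fix A k := if k is j.+1 then comp_op (A j) (U j) else V.
pose B := fix B k := if k is j.+1 then comp_op (U' j) (B j) else pow_op V M.-1.
have AB k : unitary_pair (A k) (B k).
  elim: k => [|k IH]; last exact: unitary_pair_comp.
  split=> //=; first exact: contraction_pow.
    by move=> x; rewrite -pow_opSr prednK.
  by move=> x; rewrite -pow_opS prednK.
have AS k j x : S j (A k x) = A k (S j x).
  elim: k x => [|k IH] x //=; rewrite IH; congr (A k _).
  by rewrite !DP (linearD (S j)) !opZ SC.
have AU k j a b x : A k (D j a b x) = D j a b (A k x) by rewrite Dcomm.
(* At exponent n k all earlier factors have become trivial, so only the k-th one is left in
   [A k.+1]. *)
have An k x : pow_op (A k) (n k) x = x /\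
    pow_op (A k.+1) (n k) x = D k (expi (s k)) (expi (t k)) x.
  have step j : (forall x, pow_op (A j) (n j) x = x) -> forall q x,
      pow_op (A j.+1) (n j * q) x = D j (expi (s j) ^+ q) (expi (t j) ^+ q) x.
    move=> Aj q y; rewrite pow_comp; last by move=> ?; rewrite AU.
    by rewrite DX !exprM zn wn pow_op_mul1.
  have Ak : forall k x, pow_op (A k) (n k) x = x.
    elim=> [|j IH] y; first exact: pow_op_mul1.
    by rewrite [n _]/= step// !exprM (expiX (s j)) (expiX (t j)) (pst j).1 (pst j).2 !expr1n D1.
  by split=> //; rewrite -[in LHS](muln1 (n k)) step// !expr1.
have [|||||W [cW WA]] := @geometric_lim _ _ A d => //.
- by move=> k; case: (AB k).
- move=> k x /=; rewrite -linearB (unitary_pair_nr _ (AB k)); exact: Ud.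
have [|||||W' [cW' WB]] := @geometric_lim _ _ B d => //.
- by move=> k; case: (AB k).
- move=> k x /=; rewrite (le_trans (Ud' _ _))//.
  by rewrite (unitary_pair_nr _ (unitary_pairC (AB k))).
(* Inverses survive the limit: |T T' x - x| is at most the error of C k at T' x plus that of C' k at
   x. *)
have cancelW (T T' : boundedOp H) (C C' : nat -> boundedOp H) :
    contraction_op T' -> (forall k, unitary_pair (C k) (C' k)) ->
    (forall k x, nr (T x - C k x) <= 2 * d k * nr x) ->
    (forall k x, nr (T' x - C' k x) <= 2 * d k * nr x) -> forall x, T (T' x) = x.
  move=> /contractionP cT' CC TC TC' x.
  apply/eqP; rewrite -subr_eq0; apply/eqP/nr_small => e e0.
  have x0 : 0 < 4 * (nr x + 1) by rewrite mulr_gt0// ltr_wpDl ?nr_ge0.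
  have [k] := dlim _ (divr_gt0 e0 x0); rewrite ltr_pdivlMr// => dk.
  have [_ _ _ CK] := CC k.
  have := nr_tri (C k (T' x)) (T (T' x)) x.
  have -> : nr (C k (T' x) - x) = nr (T' x - C' k x).
    by rewrite -(unitary_pair_nr (T' x - C' k x) (CC k)) linearB/= CK.
  have := TC k (T' x); have := TC' k x; have := cT' x.
  have := d0 k; have := nr_ge0 x; move=> /= ? ? ? ? ? ?; nra.
have WW : unitary_pair W W'.
  split=> // x; last exact: (@cancelW W W' A B).
  by apply: (@cancelW W' W B A) => // k; exact: unitary_pairC.
have WV x : nr (W x - V x) <= eps * nr x.
  rewrite (le_trans (WA 0%N x))// ler_wpM2r ?nr_ge0//.
  rewrite /d mulrA ler_pdivrMr// (mulrC eps) -ler_pdivrMr//.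
  rewrite (le_trans (ltW (truncnS_gt _)))// ler_nat -/K.
  by rewrite leq_pmull.
exists W, W'; split=> //.
have near_lam x y : exists2 a : nat -> R, (forall e, 0 < e -> \forall k \near \oo, a k < e) &
    forall k, nr (<[pow_op W (n k) x, y]> - (expi (s k) + expi (t k)) / 2 * <[x, y]>) <= a k.
  (* The first summand bounds the factors after the k-th, as n k times 2 d (k + 1) is at most 2 c /
     (k + 2). The second bounds the [S k] part of the k-th power, whose coefficient has modulus at
     most 1. *)
  exists (fun k => 2 * c / k.+1%:R * (nr x * nr y) + nr (<[S k x, y]>)).
    move=> e e0; have e20 : 0 < e / 2 by rewrite divr_gt0.
    have := Sw x y; move=> /nr_cvgCP/(_ _ e20).
    pose B1 := (2 * c * (nr x * nr y)) / (e / 2).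
    have : \forall k \near \oo, (Num.truncn B1 <= k)%N by exact: nbhs_infty_ge.
    apply: filterS2 => k Bk; rewrite sub0r nrN => Se.
    have : B1 < k.+1%:R by rewrite (lt_le_trans (truncnS_gt _))// ler_nat ltnS.
    rewrite /B1 ltr_pdivrMr// => ?.
    have : 2 * c / k.+1%:R * (nr x * nr y) < e / 2.
      by rewrite mulrAC ltr_pdivrMr// [ltRHS]mulrC.
    by move=> ?; rewrite [e]splitr; exact: ltrD.
  move=> k; rewrite (le_trans (nr_tri <[pow_op (A k.+1) (n k) x, y]> _ _))//.
  apply: lerD.
    rewrite -ipBl (le_trans (cauchy_schwarz _ _))// mulrA ler_wpM2r ?nr_ge0//.
    have cA : contraction_op (A k.+1) by case: (AB k.+1).
    rewrite (le_trans (pow_op_close cW cA (WA k.+1) (n k) x))// ler_wpM2r ?nr_ge0//.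
    have nd : (n k)%:R * d k = c by rewrite /d mulrC divfK.
    have := ler_wpM2l (ltW (n0 k)) (dS k); rewrite [X in _ <= X]mulrA nd => h.
    rewrite mulrCA -mulrA ler_pM2l// (le_trans h)// ler_wpM2l ?(ltW pi2)//.
    by rewrite lef_pV2 ?posrE// ler_nat.
  rewrite (An k x).2 DP ipDl !ipZl addrAC subrr add0r nrM.
  rewrite ler_piMl ?nr_ge0// nrM.
  rewrite nr_half.
  rewrite ler_pdivrMr// mul1r (le_trans (nrD _ _))// nrN !nr_expi; lra.
apply: disk_rigid_crit => l l1.
have inv0 j : 0 < j.+1%:R^-1 :> R by rewrite invr_gt0.
(* Pass to a subsequence whose j-th target is within 1 / (j + 1) of [l]. *)
have [kk [kinc kkP]] := increasing_choice (fun j N => dense_st l _ N l1 (inv0 j)).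
exists (n \o kk); split=> [i j ij|x y]; first by rewrite /= n_inc// kinc.
have [a a0 aP] := near_lam x y.
apply/nr_cvgCP => e e0; have e20 : 0 < e / 2 by rewrite divr_gt0.
pose B1 := (nr (<[x, y]>)) / (e / 2).
have := a0 _ e20; case=> N _ aN.
have : \forall k \near \oo, (maxn N (Num.truncn B1) <= k)%N by exact: nbhs_infty_ge.
apply: filterS => k; rewrite geq_max => /andP[Nk Bk].
have kkk i : (i <= kk i)%N.
  by elim: i => // i IH; rewrite (leq_ltn_trans IH)// kinc.
have := aP (kk k); have := aN (kk k) (leq_trans Nk (kkk k)) => /= h1 h2.
set m := (expi (s (kk k)) + expi (t (kk k))) / 2 in h2.
have h3 := nr_tri (m * <[x, y]>) (l * <[x, y]>) <[pow_op W (n (kk k)) x, y]>.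
move: h3; rewrite -mulrBl nrM.
have := kkP k; rewrite -/m => h4 h3.
have : nr (l - m) * nr (<[x, y]>) < e / 2.
  have B1k : B1 < k.+1%:R by rewrite (lt_le_trans (truncnS_gt _))// ler_nat ltnS.
  move: B1k; rewrite /B1 ltr_pdivrMr// => B1k.
  apply: (@le_lt_trans _ _ (k.+1%:R^-1 * nr (<[x, y]>))).
    apply: ler_wpM2r; first exact: nr_ge0.
    by rewrite nrBC (ltW h4).
  by rewrite [ltLHS]mulrC ltr_pdivrMr// [ltRHS]mulrC.
move=> h5; rewrite (le_lt_trans h3)// [e]splitr ltrD//.
by rewrite nrBC (le_lt_trans h2 h1).
Qed.

End Perturbation.

(** * The shift model *)

Lemma lxorK b : involutive (Nat.lxor ^~ b).
Proof.
by move=> a; rewrite PeanoNat.Nat.lxor_assoc PeanoNat.Nat.lxor_nilpotent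
  PeanoNat.Nat.lxor_0_r.
Qed.

Section ShiftModel.
Context {R : realType} {H : hilbertType R}.
Variable e : nat -> H.
Hypothesis eB : hbasis e.
Implicit Types (x y : H) (S T U : boundedOp H).

Local Notation "'<[' x , y ]>" := (inner x y).

Variable N : nat.

(* The basis is split into [N + 1] copies of itself: [e (idx c j)] is the
   [j]-th vector of the [c]-th copy. *)
Let idx c j := (j * N.+1 + c)%N.

Let idx_mod c j : (c <= N)%N -> (idx c j %% N.+1 = c)%N.
Proof. by move=> cN; rewrite /idx modnMDl modn_small. Qed.

Let idx_div c j : (c <= N)%N -> (idx c j %/ N.+1 = j)%N.
Proof. by move=> cN; rewrite /idx divnMDl// divn_small ?addn0. Qed.

Let idxK n : idx (n %% N.+1)%N (n %/ N.+1)%N = n.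
Proof. by rewrite /idx -divn_eq. Qed.

Let mod_le n : (n %% N.+1 <= N)%N.
Proof. by rewrite -ltnS ltn_pmod. Qed.

Let basis_idx (P : nat -> Prop) :
  (forall c j, (c <= N)%N -> P (idx c j)) -> forall n, P n.
Proof. by move=> Pi n; rewrite -(idxK n); exact: Pi. Qed.

Let idx_op (g h : nat -> nat) : (forall c, (c <= N)%N -> (g c <= N)%N) ->
  {in [pred c | (c <= N)%N] &, injective g} -> injective h ->
  exists T, contraction_op T /\
    forall c j, (c <= N)%N -> T (e (idx c j)) = e (idx (g c) (h j)).
Proof.
move=> gN gI hI; pose s (n : nat) := idx (g (n %% N.+1)%N) (h (n %/ N.+1)%N).
have [|T [cT TE]] := @basis_map _ _ _ eB s.
  move=> /= m n smn; rewrite -(idxK m) -(idxK n); congr idx.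
    apply: gI; rewrite ?inE ?mod_le//.
    by rewrite -(@idx_mod (g (m %% N.+1)%N) (h (m %/ N.+1)%N)) ?gN// -/(s m) smn idx_mod ?gN.
  apply: hI.
  by rewrite -(@idx_div (g (m %% N.+1)%N) (h (m %/ N.+1)%N)) ?gN// -/(s m) smn idx_div ?gN.
by exists T; split=> // c j cN; rewrite TE /s idx_mod// idx_div.
Qed.

Lemma shift_rigid_model (eps : R) : 0 < eps ->
  exists (W W' V : boundedOp H) (J : nat -> boundedOp H),
  [/\ unitary_pair W W' /\ disk_rigid W, contraction_op V,
      forall x, nr (W x - V x) <= eps * nr x,
      forall c d x y, (c <= N)%N -> (d <= N)%N ->
        <[J c x, J d y]> = if c == d then <[x, y]> else 0 &
      (forall c x, (c < N)%N -> V (J c.+1 x) = J c x) /\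
      (forall x, V (J 0%N x) = J N x)].
Proof.
move=> eps0.
(* Adding [N] modulo N + 1 lowers the copy number by one cyclically, without truncated
   subtraction. *)
have [|||V [cV VE]] := @idx_op (fun c => (c + N) %% N.+1)%N id => //.
- move=> c d; rewrite !inE => cN dN /eqP; rewrite eqn_modDr !modn_small//.
  by move/eqP.
have ex_S k := @idx_op id (Nat.lxor ^~ (2 ^ k)%N) (fun c cN => cN)
  (fun c d _ _ cd => cd) (inv_inj (@lxorK _)).
have [S SP] := choice ex_S.
have cS k := (SP k).1; have SE k c j := (SP k).2 c j.
(* [J c] embeds H as the c-th copy; beyond [N] the identity is a filler value. *)
have ex_J c : exists T, contraction_op T /\ ((c <= N)%N ->
    forall j, T (e j) = e (idx c j)).
  have [cN|cN] := leqP c N; last first.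
    by exists (scalar_op 1); split=> //; case: (@unitary_pair1 R H).
  have [|T [cT TE]] := @basis_map _ _ _ eB (idx c).
    by move=> i j ij; rewrite -(idx_div i cN) ij idx_div.
  by exists T.
have [J JP] := choice ex_J.
have cJ c := (JP c).1; have JE c j (cN : (c <= N)%N) := (JP c).2 cN j.
have opE (A B : boundedOp H) : contraction_op A -> contraction_op B ->
    (forall c j, (c <= N)%N -> A (e (idx c j)) = B (e (idx c j))) -> forall x, A x = B x.
  by move=> cA cB AB; apply: (basis_op_eq eB) => //; exact: basis_idx.
have c1 : contraction_op (scalar_op 1 : boundedOp H) by case: (@unitary_pair1 R H).
have VX x : pow_op V N.+1 x = x.
  rewrite -[RHS]scalar1E; apply: opE => //; first exact: contraction_pow.
  move=> c j cN; rewrite scalar1E.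
  have -> k : pow_op V k (e (idx c j)) = e (idx ((c + N * k) %% N.+1)%N j).
    elim: k => [|k IH]; first by rewrite scalar1E muln0 addn0 modn_small.
    by rewrite pow_opS IH VE ?mod_le// modnDml -addnA mulnS [(_ * _ + _)%N]addnC.
  by rewrite addnC modnMDl modn_small.
have SS k x : S k (S k x) = x.
  rewrite -[RHS]scalar1E; apply: (opE (comp_op (S k) (S k))) => //.
    exact: contraction_comp.
  by move=> c j cN; rewrite scalar1E/= !SE// lxorK.
have SC j k x : S j (S k x) = S k (S j x).
  apply: (opE (comp_op (S j) (S k)) (comp_op (S k) (S j))); try exact: contraction_comp.
  move=> c i cN /=; rewrite !SE// !PeanoNat.Nat.lxor_assoc.
  by rewrite [Nat.lxor (2 ^ k) _]PeanoNat.Nat.lxor_comm.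
have SV k x : S k (V x) = V (S k x).
  apply: (opE (comp_op (S k) V) (comp_op V (S k))); try exact: contraction_comp.
  by move=> c i cN /=; rewrite !(SE, VE)// mod_le.
have Sw x y : (fun k => <[S k x, y]> : R[i]^o) @ \oo --> (0 : R[i]^o).
  rewrite -(mul0r (<[x, y]>)); apply: (basis_weak_cvg eB) => // i j.
  rewrite mul0r; apply: cvg_near_cst.
  (* A nonzero entry needs the in-copy indices to have exclusive or 2^k > k, impossible from this
     bound on. *)
  exists (Nat.lxor (i %/ N.+1)%N (j %/ N.+1)%N) => // k /= kij.
  rewrite -(idxK i) SE ?mod_le// eB.1; case: eqP => //= ij; exfalso.
  have : (j %/ N.+1 = Nat.lxor (i %/ N.+1) (2 ^ k))%N by rewrite -ij idx_div ?mod_le.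
  move=> h; move: kij; rewrite h -PeanoNat.Nat.lxor_assoc PeanoNat.Nat.lxor_nilpotent.
  by rewrite PeanoNat.Nat.lxor_0_l leqNgt ltn_expl.
have [W [W' [WW Wr WV]]] := disk_rigid_perturb (ltn0Sn N) cV VX cS SS SC SV Sw eps0.
exists W, W', V, J; split=> //.
- move=> c d x y cN dN.
  (* Orthogonality of distinct copies is obtained from [basis_ip_eq] by comparison with the zero
     operator. *)
  have c0 : contraction_op (scalar_op 0 : boundedOp H).
    by apply/contractionP => z; rewrite scalar_opE scale0r nr0 nr_ge0.
  case: (eqVneq c d) => [<-|cd].
    have := @basis_ip_eq _ _ _ eB (J c) (J c) (scalar_op 1) (scalar_op 1) (cJ c) (cJ c) c1 c1.
    move=> ->; rewrite ?scalar1E// => i j; rewrite !JE// !scalar1E !eB.1.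
    by congr (_%:R); rewrite /idx eqn_add2r eqn_pmul2r.
  have := @basis_ip_eq _ _ _ eB (J c) (J d) (scalar_op 0) (scalar_op 0) (cJ c) (cJ d) c0 c0.
  move=> ->; first by rewrite !scalar_opE !scale0r ip0l.
  move=> i j; rewrite !JE// !scalar_opE !scale0r ip0l eB.1.
  case: eqP => // ij; case/eqP: cd.
  by rewrite -(idx_mod i cN) ij idx_mod.
- split=> [c x cN|x].
    apply: (@basis_op_eq _ _ _ eB (comp_op V (J c.+1)) (J c)) => //.
      exact: contraction_comp.
    move=> j /=; rewrite !JE//; last exact: ltnW.
    by rewrite VE// addSnnS -modnDmr modnn addn0 modn_small// ltnW.
  apply: (@basis_op_eq _ _ _ eB (comp_op V (J 0%N)) (J N)) => //.
    exact: contraction_comp.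
  by move=> j /=; rewrite !JE// VE// add0n modn_small.
Qed.

End ShiftModel.

(** * Dilation and weak density *)

Section Dilation.
Context {R : realType} {H : hilbertType R}.
Hypotheses (Hsep : separable H) (Hinf : ~ finite_dimensional H).
Implicit Types (x y : H) (S T U : boundedOp H).

Local Notation "'<[' x , y ]>" := (inner x y).

Lemma disk_rigid_conj U U' S S' : unitary_pair S S' -> unitary_pair U U' ->
  disk_rigid U -> disk_rigid (comp_op S' (comp_op U S)).
Proof.
move=> SS UU Ur; apply: disk_rigid_crit => l l1.
have [n [ni nl]] := disk_rigid_pow Ur l1.
exists n; split=> // x y.
have [_ _ SK SK'] := SS.
have powE k z : pow_op (comp_op S' (comp_op U S)) k z = S' (pow_op U k (S z)).
  elim: k => [|k IH]; first by rewrite !scalar1E SK.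
  by rewrite pow_opS IH/= SK'.
have -> : l * <[x, y]> = l * <[S x, S y]>.
  by rewrite (isometry_ip _ _ (fun x => unitary_pair_nr x SS)).
under eq_fun do rewrite powE (unitary_pair_ip _ _ (unitary_pairC SS)).
exact: nl.
Qed.

(** * The defect form and the truncated dilation *)

Section Defect.
Variable A : boundedOp H.
Variable r : R.
Hypotheses (r0 : 0 < r) (r1 : r < 1) (Ar : forall x, nr (A x) <= r * nr x).

(** The form <(I - A^* A) x, y>, positive definite because r < 1. *)
Let q x y := <[x, y]> - <[A x, A y]>.

Let pow_nr k x : nr (pow_op A k x) <= r ^+ k * nr x.
Proof.
elim: k => [|k IH]; first by rewrite scalar1E mul1r.
by rewrite pow_opS (le_trans (Ar _))// exprS -mulrA ler_pM2l.
Qed.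

Let q_tele k x y :
  \sum_(c < k) q (pow_op A c x) (pow_op A c y) = <[x, y]> - <[pow_op A k x, pow_op A k y]>.
Proof.
elim: k => [|k IH]; first by rewrite big_ord0 !scalar1E subrr.
by rewrite big_ord_recr/= IH /q addrA subrK.
Qed.

(** [D] stands in for the square root of I - A^* A; on finitely many vectors a factorization of
    their Gram matrix suffices. *)
Lemma defect_factor (e : nat -> H) (x : nat -> H) L : hbasis e ->
  exists D : H -> H, forall m n, (m < L)%N -> (n < L)%N ->
    <[D (x m), D (x n)]> = q (x m) (x n).
Proof.
move=> eB; have [|||h hP] := @gram_factor R H q _ _ _ Hinf x L.
- by move=> a u v w; rewrite /q linearP !ipDl !ipZl; ring.
- by move=> u v; rewrite /q (ipC u v) (ipC (A u)) rmorphB.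
- move=> u u0; rewrite /q !ip_nr -rmorphB/= ltcR subr_gt0.
  rewrite ltr_pXn2r ?nnegrE ?nr_ge0// (le_lt_trans (Ar _))//.
  by rewrite gtr_pMl// nr_gt0.
exists (fun y => \sum_(j < L) h y j *: e j) => m n mL nL.
by rewrite (ip_sum_sum _ (h (x m)) (h (x n)) eB.1) hP.
Qed.

(* Schaeffer's dilation, truncated: copies [0, .., n] carry [D x], [D (A x)],
   .., [D (A^n x)], where [D] is the defect map above, and copy [n + 1] carries
   [A^(n+1) x].  Every error term contains [A^n]. *)
Lemma dilation (e : nat -> H) (x : nat -> H) m n (V : boundedOp H)
    (J : nat -> boundedOp H) (b : R) : hbasis e -> (0 < m)%N ->
  (forall i, (i < m)%N -> nr (x i) <= b) ->
  (forall c d x y, (c <= n.+1)%N -> (d <= n.+1)%N ->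
    <[J c x, J d y]> = if c == d then <[x, y]> else 0) ->
  (forall c x, (c < n.+1)%N -> V (J c.+1 x) = J c x) ->
  (forall x, V (J 0%N x) = J n.+1 x) ->
  exists f : nat -> H,
    (forall i j, (i < m)%N -> (j < m)%N -> <[f i, f j]> = <[x i, x j]>) /\
    (forall i j, (i < m)%N -> (j < m)%N ->
       nr (<[V (f i), f j]> - <[A (x i), x j]>) <= 3 * r ^+ n * b ^+ 2).
Proof.
move=> eB m0 xb Jip VJ VJ0.
pose N := n.+1.
(* All vectors A^c x_i are listed in one sequence, so that a single [D] serves them all. *)
pose z k := pow_op A (k %/ m)%N (x (k %% m)%N).
have zE c i : (i < m)%N -> z (c * m + i)%N = pow_op A c (x i).
  by move=> im; rewrite /z divnMDl// divn_small// addn0 modnMDl modn_small.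
have [D DP] := defect_factor z (N.+1 * m)%N eB.
have zL c i : (c <= N)%N -> (i < m)%N -> (c * m + i < N.+1 * m)%N.
  move=> cN im; rewrite (@leq_trans (c.+1 * m))%N ?leq_mul2r ?ltnS ?cN ?orbT//.
  by rewrite mulSn addnC ltn_add2r.
have DE c d i j : (c <= N)%N -> (d <= N)%N -> (i < m)%N -> (j < m)%N ->
    <[D (pow_op A c (x i)), D (pow_op A d (x j))]> =
    q (pow_op A c (x i)) (pow_op A d (x j)).
  by move=> cN dN im jm; rewrite -!zE// DP ?zL.
have Dn c i : (c <= N)%N -> (i < m)%N ->
    nr (D (pow_op A c (x i))) <= nr (pow_op A c (x i)).
  move=> cN im; rewrite -(@ler_pXn2r _ 2) ?nnegrE ?nr_ge0// -lecR -ip_nr DE//.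
  by rewrite /q !ip_nr -rmorphB/= lecR gerBl sqr_ge0.
(* [v i] lists the components of [f i] and [v' i] those of V (f i); the cyclic shift brings
   component 0 to copy [N]. *)
pose v i c := if (c < N)%N then D (pow_op A c (x i)) else pow_op A N (x i).
pose v' i c := if (c < N)%N then v i c.+1 else v i 0%N.
pose f i := \sum_(c < N.+1) J c (v i c).
have ipJ (u w : nat -> H) :
    <[\sum_(c < N.+1) J c (u c), \sum_(c < N.+1) J c (w c)]> =
    \sum_(c < N.+1) <[u c, w c]>.
  rewrite ip_suml; apply: eq_bigr => c _.
  rewrite ip_sumr (bigD1 c)//= Jip ?leq_ord// eqxx big1 ?addr0// => d dc.
  by rewrite Jip ?leq_ord// eq_sym (negPf (dc : (d != c :> nat))).
have Vf i : V (f i) = \sum_(c < N.+1) J c (v' i c).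
  rewrite /f big_ord_recl linearD linear_sum/= VJ0 [RHS]big_ord_recr/= addrC.
  congr (_ + _); first by rewrite /v' ltnn.
  by apply: eq_bigr => c _; rewrite /bump/= add1n VJ// /v' ltn_ord.
have fip i j : (i < m)%N -> (j < m)%N -> <[f i, f j]> = <[x i, x j]>.
  move=> im jm; rewrite ipJ big_ord_recr/= /v ltnn.
  under eq_bigr => c _ do rewrite ltn_ord (DE c c i j (ltnW (ltn_ord c)) (ltnW (ltn_ord c)) im jm).
  by rewrite q_tele subrK.
exists f; split=> // i j im jm.
rewrite Vf ipJ big_ord_recr/= /v' ltnn big_ord_recr/= ltnSn.
(* The first n copies telescope to the main term minus [t1]. Copy n contributes [t2] and the
   wrap-around copy [t3]; each of the three contains A^N applied to some x. *)
have -> : \sum_(c < n) <[if (c < N)%N then v i c.+1 else v i 0%N, v j c]> =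
    <[A (x i), x j]> - <[pow_op A N (x i), pow_op A n (x j)]>.
  rewrite /N pow_opSr -q_tele; apply: eq_bigr => c _.
  have cn := ltn_ord c; have cN : (c < n.+1)%N by exact: ltnW.
  by rewrite cN /v ltnS cn cN -pow_opSr DE// ltnW.
rewrite /v ltnn ltnSn ltn0Sn scalar1E.
set t1 := <[pow_op A N (x i), _]>; set t2 := <[pow_op A N (x i), _]>.
set t3 := <[D _, _]>.
have b0 : 0 <= b by apply: le_trans (xb _ im); exact: nr_ge0.
have rn0 : 0 <= r ^+ n by rewrite exprn_ge0// ltW.
have rn1 k : r ^+ k <= 1 by rewrite exprn_ile1 ?ltW.
have pN k : (k < m)%N -> nr (pow_op A N (x k)) <= r ^+ n * b.
  move=> km; rewrite (le_trans (pow_nr _ _))// ler_pM ?nr_ge0 ?xb//.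
    by rewrite exprn_ge0// ltW.
  by rewrite exprS ler_piMl// ltW.
have p1 k l : (l < m)%N -> nr (pow_op A k (x l)) <= b.
  move=> lm; rewrite (le_trans (pow_nr _ _))// (le_trans _ (xb _ lm))//.
  by rewrite ler_piMl ?nr_ge0.
have bound u w : nr u <= r ^+ n * b -> nr w <= b -> nr <[u, w]> <= r ^+ n * b ^+ 2.
  move=> ub wb; rewrite (le_trans (cauchy_schwarz _ _))// expr2 mulrA.
  by rewrite ler_pM ?nr_ge0.
have h1 : nr t1 <= r ^+ n * b ^+ 2 by apply: bound; [exact: pN|exact: p1].
have h2 : nr t2 <= r ^+ n * b ^+ 2.
  by apply: bound; [exact: pN|rewrite (le_trans (Dn _ _ _ _)) ?p1].
have h3 : nr t3 <= r ^+ n * b ^+ 2.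
  rewrite /t3 ipC nr_conj; apply: bound; first exact: pN.
  by have := Dn 0%N i (leq0n _) im; rewrite scalar1E => /le_trans; apply; exact: xb.
have -> : <[A (x i), x j]> - t1 + t2 + t3 - <[A (x i), x j]> = - t1 + t2 + t3 by ring.
have -> : 3 * r ^+ n * b ^+ 2 = r ^+ n * b ^+ 2 + r ^+ n * b ^+ 2 + r ^+ n * b ^+ 2.
  by ring.
rewrite (le_trans (nrD _ _))// lerD// (le_trans (nrD _ _))// nrN lerD//.
Qed.

End Defect.

Lemma disk_rigid_weakly_dense (T : boundedOp H) (x : nat -> H) m (eps : R) :
  contraction_op T -> 0 < eps -> exists U U', [/\ unitary_pair U U', disk_rigid U &
    forall i j, (i < m)%N -> (j < m)%N -> nr (<[U (x i), x j]> - <[T (x i), x j]>) < eps].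
Proof.
move=> /contractionP cT eps0.
wlog m0 : m / (0 < m)%N.
  move=> h; have [U [U' [UU Ur Ux]]] := h m.+1 (ltn0Sn m).
  by exists U, U'; split=> // i j im jm; apply: Ux; exact: ltnW.
have [e eB] := hbasis_exists Hsep Hinf.
pose b : R := \sum_(i < m) nr (x i).
have b0 : 0 <= b by apply: sumr_ge0 => i _; exact: nr_ge0.
have xb i : (i < m)%N -> nr (x i) <= b.
  move=> im; rewrite /b (bigD1 (Ordinal im))//= lerDl.
  by apply: sumr_ge0 => j _; exact: nr_ge0.
pose b1 := b ^+ 2 + 1; have b10 : 0 < b1 by rewrite ltr_wpDl ?sqr_ge0.
have bb1 : b ^+ 2 <= b1 by rewrite lerDl.
(* Perturbation, dilation and scaling by [r] each cost at most h b^2 <= eps / 4. *)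
pose h := eps / (4 * b1); have h0 : 0 < h by rewrite divr_gt0// mulr_gt0.
have hb : h * b1 = eps / 4 by rewrite /h; field; rewrite gt_eqF.
(* This gives both r < 1 and 1 - r <= h. *)
pose r := (1 + h)^-1.
have h1 : 0 < 1 + h by rewrite ltr_wpDr// ltW.
have r0 : 0 < r by rewrite invr_gt0.
have r1 : r < 1 by rewrite invf_lt1// ltrDl.
have r1h : 1 - r <= h.
  by rewrite -(ler_pM2r h1) mulrBl mulVf ?gt_eqF// mul1r; nra.
have [n rn] : exists n, 3 * r ^+ n < h.
  have : (fun n => r ^+ n) @ \oo --> (0 : R^o).
    by apply: cvg_expr; rewrite gtr0_norm.
  move=> /cvgrPdist_lt/(_ (h / 3)); rewrite divr_gt0// => /(_ isT)[n _ /(_ n (leqnn n))].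
  rewrite /= sub0r normrN ger0_norm ?exprn_ge0 ?(ltW r0)//.
  by rewrite ltr_pdivlMr// mulrC; exists n.
pose A := comp_op (scalar_op r%:C) T.
have AE y : A y = r%:C *: T y by [].
have Ar y : nr (A y) <= r * nr y.
  by rewrite AE nrZ nr_real gtr0_norm// ler_pM2l.
have [W [W' [V [J [[WW Wr] cV WV Jip [VJ VJ0]]]]]] := @shift_rigid_model _ _ e eB n.+1 h h0.
have [f [fip Vf]] := dilation r0 r1 Ar eB m0 xb Jip VJ VJ0.
(* [S] takes each x i to its dilated image f i, so conjugating by it moves the matrix entries of [W]
   back to the given vectors. *)
have [S [S' [SS Sx]]] := @gram_unitary R H m x f (fun i j im jm => esym (fip i j im jm)).
exists (comp_op S' (comp_op W S)), (comp_op (comp_op S' W') S); split.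
- exact: unitary_pair_comp (unitary_pairC SS) (unitary_pair_comp WW SS).
- exact: disk_rigid_conj SS WW Wr.
move=> i j im jm /=.
rewrite (unitary_pair_ip _ _ (unitary_pairC SS)) !Sx//.
have e1 : nr (<[W (f i), f j]> - <[V (f i), f j]>) <= h * b ^+ 2.
  rewrite -ipBl (le_trans (cauchy_schwarz _ _))//.
  have fn k : (k < m)%N -> nr (f k) <= b.
    by move=> km; rewrite -(Sx k km) (unitary_pair_nr _ SS) xb.
  have := WV (f i); have := fn _ im; have := fn _ jm.
  have := nr_ge0 (f i); have := nr_ge0 (f j); have := nr_ge0 (W (f i) - V (f i)).
  move: (nr (W (f i) - V (f i))) (nr (f i)) (nr (f j)) => a1 a2 a3 ? ? ? ? ? w1.
  rewrite expr2 mulrA; apply: ler_pM => //.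
  by rewrite (le_trans w1)// ler_wpM2l// ltW.
have e3 : nr (<[A (x i), x j]> - <[T (x i), x j]>) <= h * b ^+ 2.
  rewrite AE ipZl -{2}(mul1r (<[T (x i), x j]>)) -mulrBl nrM.
  have -> : nr (r%:C - 1 : R[i]) = 1 - r.
    rewrite -[1 in LHS](rmorph1 (real_complex R)) -rmorphB/= nr_real distrC.
    by rewrite ger0_norm// subr_ge0 ltW.
  apply: ler_pM => //; [by rewrite subr_ge0 ltW|exact: nr_ge0|].
  rewrite (le_trans (cauchy_schwarz _ _))// expr2 ler_pM ?nr_ge0 ?xb//.
  by rewrite (le_trans (cT _))// xb.
have e2 : nr (<[V (f i), f j]> - <[A (x i), x j]>) <= h * b ^+ 2.
  by rewrite (le_trans (Vf _ _ im jm))// ler_wpM2r ?sqr_ge0// ltW.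
have hb2 : h * b ^+ 2 <= eps / 4 by rewrite -hb ler_pM2l.
apply: (le_lt_trans (nr_tri (<[V (f i), f j]>) _ _)).
apply: (@le_lt_trans _ _ (eps / 4 + (eps / 4 + eps / 4))); last by lra.
apply: lerD; first exact: le_trans e1 hb2.
apply: (le_trans (nr_tri (<[A (x i), x j]>) _ _)).
by apply: lerD; [exact: le_trans e2 hb2|exact: le_trans e3 hb2].
Qed.

End Dilation.

(** * Density and G-delta sets *)

Section StrongConvergence.
Context {R : realType} {H : hilbertType R} {X : Type} {F : set_system X}.
Context {FF : Filter F}.
Variables (f : X -> boundedOp H) (T : boundedOp H).
Hypothesis fc : \forall t \near F, contraction_op (f t).

Local Notation "'<[' x , y ]>" := (inner x y).

(** |f x - T x|^2 = |f x|^2 + |x|^2 - 2 Re <f x, T x> is at most 2 |x|^2 - 2 Re <f x, T x>, which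
    tends to 0. *)
Lemma weak_strong_cvg : (forall x, nr (T x) = nr x) ->
  (forall x y, (fun t => <[f t x, y]> : R[i]^o) @ F --> (<[T x, y]> : R[i]^o)) ->
  forall x, f t x @[t --> F] --> T x.
Proof.
move=> iT fT x; apply/nr_cvgP => e e0.
have e20 : 0 < e ^+ 2 / 2 by rewrite divr_gt0// exprn_gt0.
have /nr_cvgCP/(_ _ e20) := fT x (T x).
apply: filterS2 fc => t /contractionP/(_ x) ftx h.
rewrite -(@ltr_pXn2r _ 2) ?nnegrE ?nr_ge0 ?(ltW e0)// nrBC nrB_sqr iT.
have := Re_le_nr (<[T x, T x]> - <[f t x, T x]>).
have -> : complex.Re (<[T x, T x]> - <[f t x, T x]>) =
    nr x ^+ 2 - complex.Re <[f t x, T x]>.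
  by rewrite ip_nr iT; case: (<[_, _]>).
move=> /(le_trans (ler_norm _)) h1; have h2 := le_lt_trans h1 h.
have : nr (f t x) ^+ 2 <= nr x ^+ 2 by rewrite ler_pXn2r ?nnegrE ?nr_ge0.
by move: h2; rewrite ltr_pdivlMr// => h2 h3; lra.
Qed.

(** The next power is compared with f (T^n x): a contraction does not enlarge the previous error,
    and f converges at the fixed vector T^n x. *)
Lemma pow_strong_cvg : (forall x, f t x @[t --> F] --> T x) ->
  forall n x, pow_op (f t) n x @[t --> F] --> pow_op T n x.
Proof.
move=> fT; elim=> [|n IH] x.
  by under eq_fun do rewrite scalar1E; rewrite scalar1E; exact: cvg_cst.
apply/nr_cvgP => e e0; have e20 : 0 < e / 2 by rewrite divr_gt0.
have /nr_cvgP/(_ _ e20) := fT (pow_op T n x).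
have /nr_cvgP/(_ _ e20) := IH x.
apply: filterS3 fc => t /contractionP/(_ (pow_op T n x - pow_op (f t) n x)).
rewrite linearB => h1 h2 h3; rewrite !pow_opS.
rewrite (le_lt_trans (nr_tri (f t (pow_op T n x)) _ _))// [e]splitr ltrD//.
exact: le_lt_trans h2.
Qed.

End StrongConvergence.

Section RigidityGdelta.
Context {R : realType} {H : hilbertType R}.
Variables (e : nat -> H) (lam : nat -> R[i]).
Hypotheses (eB : hbasis e) (lam1 : forall k, nr (lam k) <= 1)
  (lamD : forall (l : R[i]) (eps : R) N, nr l <= 1 -> 0 < eps ->
    exists k, (N <= k)%N /\ nr (lam k - l) < eps).

Local Notation "'<[' x , y ]>" := (inner x y).

(** One index controls the target, the least exponent, the number of basis vectors and the
    precision. This loses nothing because the targets approach each point of the disk at arbitrarily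
    large indices. *)
Definition rigid_at (k : nat) : set (boundedOp H) :=
  [set T | exists2 n, (k <= n)%N & forall i j : 'I_k,
    nr (<[pow_op T n (e i), e j]> - lam k * <[e i, e j]>) < k.+1%:R^-1].

Lemma disk_rigid_rigid_at T k : disk_rigid T -> rigid_at k T.
Proof.
move=> /disk_rigid_pow/(_ (lam1 k))[n [ni nl]].
have k0 : 0 < k.+1%:R^-1 :> R by rewrite invr_gt0.
have : \forall s \near \oo, forall ij : 'I_k * 'I_k,
    nr (lam k * <[e ij.1, e ij.2]> - <[pow_op T (n s) (e ij.1), e ij.2]>) < k.+1%:R^-1.
  by apply: filter_forall => ij; have /nr_cvgCP/(_ _ k0) := nl (e ij.1) (e ij.2).
case=> N _ /(_ (maxn N k) (leq_maxl _ _)) /= h.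
exists (n (maxn N k)); last by move=> i j; rewrite nrBC; exact: (h (i, j)).
have ns s : (s <= n s)%N by elim: s => // s IH; rewrite (leq_ltn_trans IH)// ni.
by rewrite (leq_trans (leq_maxr N k)).
Qed.

Lemma rigid_at_disk_rigid T : contraction_op T -> (forall k, rigid_at k T) ->
  disk_rigid T.
Proof.
move=> cT Tr; apply: disk_rigid_crit => l l1.
(* Of the bound 2 / (j + 1), one half is the precision of [rigid_at k] for some k >= j, the other
   the distance from [lam k] to [l]. *)
have [|n [ni nP]] := @increasing_choice (fun j n => forall i i', (i < j)%N -> (i' < j)%N ->
    nr (<[pow_op T n (e i), e i']> - l * <[e i, e i']>) < 2 / j.+1%:R).
  move=> j N; have j0 : 0 < j.+1%:R^-1 :> R by rewrite invr_gt0.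
  have [k []] := lamD (maxn j N) l1 j0; rewrite geq_max => /andP[jk Nk] kl.
  have [n kn nP] := Tr k; exists n; split=> [|i i' ij i'j].
    exact: leq_trans kn.
  have := nP (Ordinal (leq_trans ij jk)) (Ordinal (leq_trans i'j jk)) => /= h.
  rewrite (le_lt_trans (nr_tri (lam k * <[e i, e i']>) _ _))//.
  have -> : 2 / j.+1%:R = j.+1%:R^-1 + j.+1%:R^-1 :> R by rewrite mulrDl !mul1r.
  apply: ltrD.
    by apply: (lt_le_trans h); rewrite lef_pV2 ?posrE// ler_nat ltnS.
  rewrite -mulrBl nrM eB.1; case: (i == i').
    by rewrite nr1 mulr1.
  by rewrite nr0 mulr0.
exists n; split=> [|x y]; first exact: ni.
apply: (basis_weak_cvg (A := fun k => pow_op T (n k)) eB) => [k|i j].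
  exact: contraction_pow.
apply/nr_cvgCP => eps eps0.
have : \forall k \near \oo, (maxn (maxn i j).+1 (Num.truncn (2 / eps)) <= k)%N.
  exact: nbhs_infty_ge.
apply: filterS => k; rewrite !geq_max gtn_max -andbA => /and3P[ik jk Bk].
rewrite nrBC (lt_trans (nP k i j ik jk))// ltr_pdivrMr// [ltRHS]mulrC.
by rewrite -ltr_pdivrMr// (lt_le_trans (truncnS_gt _))// ler_nat ltnS.
Qed.

(** With the exponent fixed, only finitely many strict inequalities are involved, and they persist
    by strong convergence of powers. *)
Lemma rigid_at_near (X : Type) (F : set_system X) (f : X -> boundedOp H)
    (T : boundedOp H) k :
  Filter F -> (\forall t \near F, contraction_op (f t)) ->
  (forall x, f t x @[t --> F] --> T x) -> rigid_at k T ->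
  \forall t \near F, rigid_at k (f t).
Proof.
move=> FF fc fT [n kn nP].
have : \forall t \near F, forall ij : 'I_k * 'I_k,
    nr (<[pow_op (f t) n (e ij.1), e ij.2]> - lam k * <[e ij.1, e ij.2]>) < k.+1%:R^-1.
  apply: filter_forall => -[i j] /=.
  have d0 : 0 < k.+1%:R^-1 - nr (<[pow_op T n (e i), e j]> - lam k * <[e i, e j]>).
    by rewrite subr_gt0; exact: nP.
  have := @ip_conv R H X F _ _ (e j) FF (@pow_strong_cvg R H X F FF f T fc fT n (e i)).
  move=> /nr_cvgCP/(_ _ d0).
  apply: filterS => t; rewrite ltrBrDr => h.
  by rewrite (le_lt_trans (nr_tri (<[pow_op T n (e i), e j]>) _ _))// nrBC.
by apply: filterS => t h; exists n => // i j; exact: (h (i, j)).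
Qed.

End RigidityGdelta.

Section Density.
Context {R : realType} {H : hilbertType R}.
Hypotheses (Hsep : separable H) (Hinf : ~ finite_dimensional H).

Local Notation "'<[' x , y ]>" := (inner x y).

(** The filter plays the part of a net and serves all three topologies, weak convergence to an
    isometry being strong. *)
Lemma disk_rigid_filter (T : boundedOp H) : contraction_op T ->
  exists F : set_system (boundedOp H), [/\ ProperFilter F,
    F [set U | unitary_op U /\ disk_rigid U] &
    forall x y, (fun U : boundedOp H => <[U x, y]> : R[i]^o) @ F -->
      (<[T x, y]> : R[i]^o)].
Proof.
move=> cT.
(* [F] is generated by the disk-rigid unitaries weakly close to [T] on finite
   sets of vectors. *)
pose F : set_system (boundedOp H) := [set A | exists (L : seq H) (eps : R),
  0 < eps /\ forall U, unitary_op U /\ disk_rigid U ->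
  (forall i j, (i < size L)%N -> (j < size L)%N ->
    nr (<[U L`_i, L`_j]> - <[T L`_i, L`_j]>) < eps) -> A U].
have FF : Filter F.
  split.
  - by exists [::], 1.
  - move=> A B [L [a [a0 LA]]] [K [b [b0 KB]]].
    exists (L ++ K), (Num.min a b); split; first by rewrite lt_min a0 b0.
    move=> U Ur UL; split.
      apply: LA => // i j iL jL; have := UL i j; rewrite size_cat !nth_cat iL jL.
      by rewrite !ltn_addr// => /(_ isT isT); rewrite lt_min => /andP[].
    apply: KB => // i j iL jL; have := UL (size L + i)%N (size L + j)%N.
    rewrite size_cat !nth_cat !ltnNge !leq_addr/= -!ltnNge !ltn_add2l iL jL !addKn.
    by move=> /(_ isT isT); rewrite lt_min => /andP[].
  - by move=> A B AB [L [a [a0 LA]]]; exists L, a; split=> // U Ur /(LA _ Ur)/AB.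
exists F; split.
- apply: Build_ProperFilter_ex => // A [L [a [a0 LA]]].
  have [U [U' [UU Ur UL]]] :=
    disk_rigid_weakly_dense Hsep Hinf (nth 0 L) (size L) cT a0.
  by exists U; apply: LA => //; split=> //; apply/unitary_opP; exists U'.
- by exists [::], 1; split.
- move=> x y; apply/nr_cvgCP => eps eps0.
  exists [:: x; y], eps; split=> // U _ /(_ 0%N 1%N isT isT)/= h.
  by rewrite nrBC.
Qed.

Lemma dense_trace (tau : topologicalType) (A P : set tau) :
  (forall T, A T -> exists F : set_system tau,
    [/\ ProperFilter F, F [set U | A U /\ P U] & F --> T]) ->
  dense (@trace_in tau A P).
Proof.
move=> AP O [x Ox] [B oB BO]; rewrite -BO in Ox *.
have [F [PF FAP FT]] := AP _ (set_mem (valP x)).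
have : F B by apply: FT; exact: open_nbhs_nbhs.
move=> FB; have [U [BU [AU PU]]] := filter_ex (filterI FB FAP).
by exists (exist _ U (mem_set AU)).
Qed.

Lemma unitary_isometry (U : boundedOp H) x : unitary_op U -> nr (U x) = nr x.
Proof. by move=> /unitary_opP[V UV]; exact: unitary_pair_nr UV. Qed.

Lemma unitary_contraction (U : boundedOp H) : unitary_op U -> contraction_op U.
Proof. by move=> /unitary_opP[V []]. Qed.

Lemma adjoint_ip (U : boundedOp H) x y : unitary_op U ->
  <[adjoint U x, y]> = (<[U y, x]>)^*.
Proof.
move=> /unitary_opP[V UV]; rewrite (adjoint_pair UV) -ipC.
by rewrite (unitary_pair_ip _ _ (unitary_pairC UV)).
Qed.

Lemma adjoint_unitary (U : boundedOp H) : unitary_op U -> unitary_op (adjoint U).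
Proof.
move=> /unitary_opP[V UV]; rewrite (adjoint_pair UV); apply/unitary_opP.
by exists U; exact: unitary_pairC.
Qed.

End Density.

Theorem theorem3p10 (R : realType) (H : hilbertType R)
    (Hsep : separable H) (Hinf : ~ finite_dimensional H) :
  [/\ dense_Gdelta (@trace_in (SOTstar H) unitary_op disk_rigid),
      dense_Gdelta (@trace_in (SOT H) isometric_op disk_rigid) &
      comeager (@trace_in (WOT H) contraction_op disk_rigid)].
Proof.
have [e eB] := hbasis_exists Hsep Hinf.
have [s [t [p [_ _ _ lamD]]]] := @disk_targets R.
set lam := fun k => (expi (s k) + expi (t k)) / 2 in lamD.
have lam1 k : nr (lam k) <= 1.
  rewrite /lam nrM nr_half ler_pdivrMr// mul1r (le_trans (nrD _ _))//.
  by rewrite !nr_expi; lra.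
have isoP (T : boundedOp H) : isometric_op T <-> forall x, nr (T x) = nr x.
  by split=> iT x; [rewrite /nr iT|rewrite !nrE iT].
have iso_contr (T : boundedOp H) : isometric_op T -> contraction_op T.
  by move=> iT x; rewrite iT.
have iso_unit (T : boundedOp H) : unitary_op T -> isometric_op T.
  by move=> uT; apply/isoP => x; exact: unitary_isometry.
have near_contr (F : set_system (boundedOp H)) : Filter F ->
    F [set U | unitary_op U /\ disk_rigid U] -> \forall U \near F, contraction_op U.
  by move=> FF; apply: filterS => U [/unitary_contraction].
split.
- split.
    exists (fun k => [set x | rigid_at e lam k (\val x)]).
      move=> k; rewrite openE => x xk /=.
      have : (\val : set_type (unitary_op : set (SOTstar H)) -> SOTstar H) @ nbhs x -->
          (\val x : SOTstar H) by exact: initial_continuous.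
      move=> /SOTstar_cvgP xc.
      have xs z : (fun y => (\val y : boundedOp H) z) @ nbhs x --> (\val x : boundedOp H) z.
        by case: (xc z).
      have cx : \forall y \near nbhs x, contraction_op (\val y).
        by apply: nearW => y; exact/unitary_contraction/set_mem/valP.
      exact: rigid_at_near cx xs xk.
    apply/seteqP; split=> x; first by move=> xr k _; exact: disk_rigid_rigid_at.
    move=> xk; apply: (rigid_at_disk_rigid eB lamD) => [|k]; last exact: xk.
    exact/unitary_contraction/set_mem/valP.
  apply: dense_trace => T uT.
  have [F [PF Fr FT]] := disk_rigid_filter Hsep Hinf (unitary_contraction uT).
  exists F; split=> //.
  apply/(@SOTstar_cvgP _ _ _ F id) => x; split.
    apply: weak_strong_cvg => //; first exact: near_contr.
    by move=> y; exact: unitary_isometry.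
  (* Adjoints converge weakly by conjugating matrix entries; being unitary with unitary limit, they
     converge strongly as well. *)
  apply: weak_strong_cvg.
  - by apply: filterS Fr => U [/adjoint_unitary/unitary_contraction].
  - by move=> y; exact/unitary_isometry/adjoint_unitary.
  - move=> y z; apply/nr_cvgCP => eps eps0.
    have /nr_cvgCP/(_ _ eps0) := FT z y.
    apply: filterS2 Fr => U [uU _] h; rewrite !adjoint_ip//.
    by rewrite -rmorphB nr_conj.
- split.
    exists (fun k => [set x | rigid_at e lam k (\val x)]).
      move=> k; rewrite openE => x xk /=.
      have : (\val : set_type (isometric_op : set (SOT H)) -> SOT H) @ nbhs x -->
          (\val x : SOT H) by exact: initial_continuous.
      move=> /SOT_cvgP xs.
      have cx : \forall y \near nbhs x, contraction_op (\val y).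
        by apply: nearW => y; exact/iso_contr/set_mem/valP.
      exact: rigid_at_near cx xs xk.
    apply/seteqP; split=> x; first by move=> xr k _; exact: disk_rigid_rigid_at.
    move=> xk; apply: (rigid_at_disk_rigid eB lamD) => [|k]; last exact: xk.
    exact/iso_contr/set_mem/valP.
  apply: dense_trace => T iT.
  have [F [PF Fr FT]] := disk_rigid_filter Hsep Hinf (iso_contr _ iT).
  exists F; split=> //; first by apply: filterS Fr => U [/iso_unit].
  apply/(@SOT_cvgP _ _ _ F id); apply: weak_strong_cvg => //; first exact: near_contr.
  exact/isoP.
(* Powers are not weakly continuous on contractions, so the sets [G k] need not
   be weakly open; but their interiors contain the disk-rigid unitaries. *)
- pose G k : set (set_type (contraction_op : set (WOT H))) :=
    [set x | rigid_at e lam k (\val x)].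
  exists (\bigcap_k (G k)°); last first.
    move=> x xk; apply: (rigid_at_disk_rigid eB lamD) => [|k].
      exact/set_mem/valP.
    by have /interior_subset := xk k I.
  split; first by exists (fun k => (G k)°) => // k; exact: open_interior.
  have : dense (@trace_in (WOT H) contraction_op
      [set U | unitary_op U /\ disk_rigid U]).
    apply: dense_trace => T cT.
    have [F [PF Fr FT]] := disk_rigid_filter Hsep Hinf cT.
    exists F; split=> //; last exact/(@WOT_cvgP _ _ _ F id).
    by apply: filterS Fr => U [uU rU]; split=> //; exact: unitary_contraction.
  (* At a unitary point, weak convergence of contractions is strong, so [rigid_at_near] yields a
     weak neighbourhood inside [G k]. *)
  move=> dG O O0 /(dG _ O0)[x [Ox [ux rx]]]; exists x; split=> // k _.
  have : (\val : set_type (contraction_op : set (WOT H)) -> WOT H) @ nbhs x -->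
    (\val x : WOT H) by exact: initial_continuous.
  move=> /WOT_cvgP xc.
  have cG : \forall y \near nbhs x, contraction_op (\val y).
    by apply: nearW => y; exact/set_mem/valP.
  apply: (rigid_at_near _ cG _ (disk_rigid_rigid_at e lam1 k rx)).
  by apply: weak_strong_cvg => // y; exact: unitary_isometry.
Qed.
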